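(* Let $n\ge 2$ be an integer and let $\nu\in\{1,2,\ldots,n-1\}$. The finite sum $C_n(\nu)=\sum_{l=1}^{n-1}\cos\frac{2\pi\nu l}{n}\cdot\csc\frac{\pi l}{n}$ admits the series representation $$\sum_{l=1}^{n-1}\cos\frac{2\pi\nu l}{n}\cdot\csc\frac{\pi l}{n}=\frac{2n}{\pi}\ln\!\left(2\sin\frac{\pi\nu}{n}\right)-\frac{2}{\pi}\left\{\Psi\!\left(\frac2n\right)-\Psi\!\left(\frac1n\right)\right\}-\frac{2}{\pi}\csc\frac{2\pi\nu}{n}\times\sum_{l=2}^{\infty}\left\{\Psi\!\left(\frac{l-1}{2n}\right)-\Psi\!\left(\frac{l+1}{2n}\right)-\Psi\!\left(\frac{l-1}{n}\right)+\Psi\!\left(\frac{l+1}{n}\right)\right\}\sin\frac{2\pi\nu l}{n},$$ where the last infinite series converges at the same rate as $\sum l^{-2}\sin(2\pi\nu l/n)$.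
   Context: $\Psi=\Gamma'/\Gamma$ denotes the digamma function.
   Formalization: For ν = n/2 (e.g. n = 2, ν = 1) the printed formula contains csc π times a zero series and is undefined; there the identity is stated with the right-hand side understood as its limit as the real variable ν tends to n/2. *)

(* Defs.v *)
(* Stdlib reals with Coquelicot. *)
From Stdlib Require Import Reals.
From Coquelicot Require Import Coquelicot.
Open Scope R_scope.

(* Euler's integral of the second kind; meaningful for x > 0. *)
Definition Gamma (x : R) : R :=
  RInt_gen (fun t => Rpower t (x - 1) * exp (- t))
           (at_right 0) (Rbar_locally p_infty).

Definition digamma (x : R) : R := Derive Gamma x / Gamma x.

(* Total: the value is only meaningful where sin x <> 0. *)
Definition csc (x : R) : R := / sin x.

(* u and v have the same order of magnitude at infinity (big-Theta). *)
Definition same_order (u v : nat -> R) : Prop :=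
  exists c1 c2 : R, 0 < c1 /\ 0 < c2 /\
    eventually (fun N => c1 * Rabs (v N) <= Rabs (u N) <= c2 * Rabs (v N)).

Definition series_tail (u : nat -> R) (N : nat) : R :=
  Series (fun k => u (N + k)%nat).

(* The series of u and v converge at the same rate: both their general terms
   and their remainders are of the same order. For series with oscillating
   signs neither of these two comparisons implies the other. *)
Definition same_rate (u v : nat -> R) : Prop :=
  ex_series u /\ ex_series v /\
  same_order u v /\ same_order (series_tail u) (series_tail v).

(* The expression in braces in the infinite series. *)
Definition psi_coef (n l : nat) : R :=
  digamma ((INR l - 1) / (2 * INR n)) - digamma ((INR l + 1) / (2 * INR n))
  - digamma ((INR l - 1) / INR n) + digamma ((INR l + 1) / INR n).

(* Main.v *)
(* Log-convexity of Gamma and the functional equation squeeze the increments of [ln Gamma],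
   so that [ln Gamma] is differentiable and
   [digamma x = lim (ln (x + N) - sum_(k < N) 1 / (x + k))]. Hence differences of digamma at
   rational points are integrals over [[0, 1]] of rational functions, and the coefficients of
   the series are [psi_coef n l = - n * int s^(l-2) (1 - s^2) / (1 + s^n)]. With
   [t = 2 PI nu / n] and [Q = 1 - 2 s cos t + s^2], summing the series under the integral sign
   and writing each cosecant as [PI csc (PI l / n) = n * int (s^(l-1) + s^(n-l-1)) / (1 + s^n)]
   turns both sides into integrals over [[0, 1]]; the integrands agree by the identity
   [cos t - s - s^(n-1) + s^n cos t
      = (s - cos t) (1 + s^n) + (1 - s^2) (2 cos t - s) - (s + s^(n-1)) Q],
   its three summands giving the logarithm, the series, and, by the duplication formula,
   [digamma (2/n) - digamma (1/n)].
   For the rate, both coefficient sequences behave like [1 / l^2] up to their second differences.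
   Two summations by parts show that the remainders are of order [1 / N^2], or [1 / N^3] at the
   indices where the leading term vanishes, and these indices depend on [t] alone. *)
Require Import Defs.
From Stdlib Require Import Reals Lra Lia.
From Coquelicot Require Import Coquelicot.
Open Scope R_scope.

(** The factor [csc (2 PI nu / n)] has no value at [nu = n / 2], so there the right-hand side has to
    be read as a limit over a real variable. This is why the logarithm and the series are evaluated
    for every real angle [t] strictly between [0] and [2 PI]; that [n t] is a multiple of [2 PI]
    enters the formula through the cosecant sum. The sum of the series carries an explicit factor
    [sin t], which cancels the cosecant and leaves an integral that is continuous at [t = PI].
    Infinite sums become integrals by exact telescoping: each partial sum is the expected integral
    minus a remainder integral of order [1 / N]. The comparison of remainders has to hold at every
    large index, including those where the leading term cancels. Two facts give the lower bounds.
    The trigonometric factors are periodic in the index, so their nonzero values stay away from [0];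
    and the factors of the leading and of the next term vanish together only if [sin t = 0]. *)

Lemma ex_RInt_of_derive (f : R -> R) (a b : R) :
  (forall t, Rmin a b <= t <= Rmax a b -> ex_derive f t) -> ex_RInt f a b.
Proof.
  intros H. apply (ex_RInt_continuous (V := R_CompleteNormedModule)). intros t Ht.
  apply (ex_derive_continuous f). now apply H.
Qed.

(** * Euler's integral *)

Definition gamma_integrand (x t : R) : R := Rpower t (x - 1) * exp (- t).

Lemma ex_RInt_gamma (x a b : R) :
  0 < a -> a <= b -> ex_RInt (gamma_integrand x) a b.
Proof.
  intros Ha Hab. apply ex_RInt_of_derive. intros t Ht.
  rewrite Rmin_left in Ht by assumption.
  unfold gamma_integrand, Rpower. auto_derive. lra.
Qed.

Lemma gamma_integrand_pos (x t : R) : 0 < gamma_integrand x t.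
Proof.
  apply Rmult_lt_0_compat; apply exp_pos.
Qed.

Lemma RInt_nonneg_subset (f : R -> R) (a a' b' b : R) :
  a <= a' -> a' <= b' -> b' <= b -> ex_RInt f a b ->
  (forall t, a < t < b -> 0 <= f t) -> RInt f a' b' <= RInt f a b.
Proof.
  intros H1 H2 H3 Hex Hpos.
  assert (E1 : ex_RInt f a a') by (apply (ex_RInt_Chasles_1 f a a' b); [lra | assumption]).
  assert (E2 : ex_RInt f a' b) by (apply (ex_RInt_Chasles_2 f a a' b); [lra | assumption]).
  assert (E3 : ex_RInt f a' b') by (apply (ex_RInt_Chasles_1 f a' b' b); [lra | assumption]).
  assert (E4 : ex_RInt f b' b) by (apply (ex_RInt_Chasles_2 f a' b' b); [lra | assumption]).
  rewrite <- (RInt_Chasles f a a' b E1 E2).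
  rewrite <- (RInt_Chasles f a' b' b E3 E4).
  change (RInt f a' b' <= RInt f a a' + (RInt f a' b' + RInt f b' b)).
  assert (0 <= RInt f a a') by (apply RInt_ge_0; [lra | assumption | intros; apply Hpos; lra]).
  assert (0 <= RInt f b' b) by (apply RInt_ge_0; [lra | assumption | intros; apply Hpos; lra]).
  lra.
Qed.

Lemma is_RInt_gen_of_approx (f : R -> R) (L : R) :
  (forall a b, 0 < a -> a <= b -> ex_RInt f a b) ->
  (forall eps, 0 < eps -> exists a0 b0, 0 < a0 /\ a0 <= b0 /\
     forall a b, 0 < a -> a <= a0 -> b0 <= b -> Rabs (RInt f a b - L) < eps) ->
  is_RInt_gen f (at_right 0) (Rbar_locally p_infty) L.
Proof.
  intros Hex Happ P [eps HP].
  destruct (Happ eps (cond_pos eps)) as (a0 & b0 & Ha0 & Hab & H).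
  apply (Filter_prod _ _ _ (fun a => 0 < a <= a0) (fun b => b0 < b)).
  - exists (mkposreal a0 Ha0). intros y Hy Hy0.
    unfold ball in Hy; simpl in Hy; unfold AbsRing_ball, abs, minus, plus, opp in Hy; simpl in Hy.
    apply Rabs_def2 in Hy. lra.
  - exists b0. intros; assumption.
  - intros a b Ha Hb. exists (RInt f a b). split.
    + apply (RInt_correct f). apply Hex; simpl; lra.
    + apply HP. apply H; lra.
Qed.

(* From [ln (t / y) <= t / y - 1]. *)
Lemma Rpower_exp_neg_bounded (y t : R) :
  0 < y -> 0 < t -> Rpower t y * exp (- t) <= exp (y * ln y).
Proof.
  intros Hy Ht. unfold Rpower. rewrite <- exp_plus.
  destruct (Rle_lt_dec (y * ln t + - t) (y * ln y)) as [[H|H]|H].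
  - left. now apply exp_increasing.
  - right. now rewrite H.
  - exfalso.
    assert (E : exp (ln t - ln y) = t / y).
    { unfold Rminus. rewrite exp_plus, exp_Ropp, !exp_ln by assumption. reflexivity. }
    destruct (Req_dec (ln t - ln y) 0) as [H0|H0].
    + replace (ln t) with (ln y) in H by lra. lra.
    + pose proof (exp_ineq1 _ H0) as H1. rewrite E in H1.
      apply (Rmult_lt_compat_l y) in H1; [|assumption].
      replace (y * (t / y)) with t in H1 by (field; lra). lra.
Qed.

(* The antiderivative [-1/(x(1+t^x))] of the majorant is bounded at both ends. *)
Lemma RInt_gamma_bounded (x : R) : 0 < x ->
  exists M, forall a b, 0 < a -> a <= b -> RInt (gamma_integrand x) a b <= M.
Proof.
  intros Hx.
  (* [K] bounds [(1 + t^x)^2 exp (- t)]: its three summands bound those of the expanded square, by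
     [Rpower_exp_neg_bounded] at [x] and at [2 x]. *)
  set (K := 1 + 2 * exp (x * ln x) + exp ((2 * x) * ln (2 * x))).
  assert (HK : 0 < K).
  { unfold K. pose proof (exp_pos (x * ln x)). pose proof (exp_pos (2 * x * ln (2 * x))). lra. }
  exists (K / x). intros a b Ha Hab.
  set (H := fun t => - (K / x) / (1 + Rpower t x)).
  set (h := fun t => K * Rpower t (x - 1) / (1 + Rpower t x) ^ 2).
  assert (Hp : forall t, 0 < 1 + Rpower t x) by (intros; pose proof (exp_pos (x * ln t));
    unfold Rpower; lra).
  assert (Hd : forall t, 0 < t -> is_derive H t (h t)).
  { intros t Ht. unfold H, h. specialize (Hp t).
    unfold Rminus. rewrite Rpower_plus, Rpower_Ropp, Rpower_1 by assumption.
    unfold Rpower in *. auto_derive; [lra|]. field. lra. }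
  assert (Hh : is_RInt h a b (minus (H b) (H a))).
  { apply (is_RInt_derive H h); intros t Ht; rewrite Rmin_left in Ht by assumption.
    - apply Hd; lra.
    - apply (ex_derive_continuous h). specialize (Hp t). unfold h, Rpower in *. auto_derive.
      repeat split; try lra. apply Rgt_not_eq. repeat apply Rmult_lt_0_compat; lra. }
  apply Rle_trans with (RInt h a b).
  - apply RInt_le; [assumption | now apply ex_RInt_gamma | eexists; exact Hh | ].
    intros t Ht. unfold gamma_integrand, h.
    assert (B : (1 + Rpower t x) ^ 2 * exp (- t) <= K).
    { pose proof (Rpower_exp_neg_bounded x t Hx ltac:(lra)).
      pose proof (Rpower_exp_neg_bounded (2 * x) t ltac:(lra) ltac:(lra)) as H2.
      replace (2 * x) with (x + x) in H2 at 1 by ring. rewrite Rpower_plus in H2.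
      assert (exp (- t) <= 1) by (left; rewrite <- exp_0; apply exp_increasing; lra).
      unfold K. nra. }
    specialize (Hp t).
    apply Rmult_le_reg_r with ((1 + Rpower t x) ^ 2); [now apply pow_lt|].
    replace (K * Rpower t (x - 1) / (1 + Rpower t x) ^ 2 * (1 + Rpower t x) ^ 2)
      with (Rpower t (x - 1) * K) by (field; lra).
    rewrite Rmult_assoc. apply Rmult_le_compat_l; [left; apply exp_pos|]. lra.
  - rewrite (is_RInt_unique _ _ _ _ Hh). unfold minus, plus, opp, H; simpl.
    assert (0 < K / x) by (apply Rdiv_lt_0_compat; assumption).
    assert (0 <= (K / x) / (1 + Rpower b x)) by (left; apply Rdiv_lt_0_compat; auto).
    assert ((K / x) / (1 + Rpower a x) <= K / x).
    { apply Rmult_le_reg_r with (1 + Rpower a x); [apply Hp|].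
      replace (K / x / (1 + Rpower a x) * (1 + Rpower a x)) with (K / x) by (specialize (Hp a); field;
        lra).
      rewrite <- (Rmult_1_r (K / x)) at 1. apply Rmult_le_compat_l; [lra|].
      pose proof (exp_pos (x * ln a)). unfold Rpower. lra. }
    unfold Rdiv in *. lra.
Qed.

(** The integrand is positive, so the integrals over [[a, b]] grow with the interval and their
    supremum is the improper integral. From here on [Gamma] is handled through integrals over
    compact intervals. *)
Lemma Gamma_approx (x : R) : 0 < x ->
  (forall a b, 0 < a -> a <= b -> RInt (gamma_integrand x) a b <= Gamma x) /\
  (forall eps, 0 < eps -> exists a0 b0, 0 < a0 /\ a0 <= b0 /\
     forall a b, 0 < a -> a <= a0 -> b0 <= b ->
       Rabs (RInt (gamma_integrand x) a b - Gamma x) < eps).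
Proof.
  intros Hx.
  destruct (RInt_gamma_bounded x Hx) as [M HM].
  set (E := fun r => exists a b, 0 < a /\ a <= b /\ r = RInt (gamma_integrand x) a b).
  destruct (completeness E) as [L [HL1 HL2]].
  { exists M. intros r (a & b & Ha & Hab & ->). now apply HM. }
  { exists (RInt (gamma_integrand x) 1 1), 1, 1. repeat split; lra. }
  assert (Hup : forall a b, 0 < a -> a <= b -> RInt (gamma_integrand x) a b <= L).
  { intros a b Ha Hab. apply HL1. now exists a, b. }
  assert (Happ : forall eps, 0 < eps -> exists a0 b0, 0 < a0 /\ a0 <= b0 /\
     forall a b, 0 < a -> a <= a0 -> b0 <= b ->
       Rabs (RInt (gamma_integrand x) a b - L) < eps).
  { intros eps Heps.
    destruct (Classical_Prop.classic (exists a0 b0, 0 < a0 /\ a0 <= b0 /\ L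
      - eps < RInt (gamma_integrand x) a0 b0))
      as [(a0 & b0 & Ha0 & Hab0 & H0)|Hn].
    - exists a0, b0. repeat split; try assumption. intros a b Ha Ha' Hb.
      assert (RInt (gamma_integrand x) a0 b0 <= RInt (gamma_integrand x) a b).
      { apply RInt_nonneg_subset; try assumption.
        - apply ex_RInt_gamma; lra.
        - intros; left; apply gamma_integrand_pos. }
      specialize (Hup a b Ha ltac:(lra)). apply Rabs_def1; lra.
    - exfalso. specialize (HL2 (L - eps)).
      enough (L <= L - eps) by lra. apply HL2. intros r (a & b & Ha & Hab & ->).
      destruct (Rle_lt_dec (RInt (gamma_integrand x) a b) (L - eps)); [assumption|].
      exfalso. apply Hn. now exists a, b. }
  assert (HG : Gamma x = L).
  { unfold Gamma. apply is_RInt_gen_unique.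
    apply is_RInt_gen_of_approx; [intros; now apply ex_RInt_gamma | exact Happ]. }
  rewrite HG. now split.
Qed.

Lemma Gamma_le (x M : R) : 0 < x ->
  (forall a b, 0 < a -> a <= b -> RInt (gamma_integrand x) a b <= M) -> Gamma x <= M.
Proof.
  intros Hx HM. apply Rnot_lt_le. intros Hlt.
  destruct (proj2 (Gamma_approx x Hx) (Gamma x - M)) as (a0 & b0 & H1 & H2 & H3); [lra|].
  specialize (H3 a0 b0 H1 ltac:(lra) ltac:(lra)). apply Rabs_def2 in H3.
  specialize (HM a0 b0 H1 H2). lra.
Qed.

Lemma Gamma_pos (x : R) : 0 < x -> 0 < Gamma x.
Proof.
  intros Hx. apply Rlt_le_trans with (RInt (gamma_integrand x) 1 2).
  - apply RInt_gt_0; [lra | intros; apply gamma_integrand_pos |].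
    intros t Ht. apply (ex_derive_continuous (gamma_integrand x)).
    unfold gamma_integrand, Rpower. auto_derive. lra.
  - apply (proj1 (Gamma_approx x Hx)); lra.
Qed.

(** Integration by parts on [[a, b]], with [a] and [b] so extreme that both truncations and both
    boundary values are small. *)
Lemma Gamma_succ (x : R) : 0 < x -> Gamma (x + 1) = x * Gamma x.
Proof.
  intros Hx. apply cond_eq. intros eps Heps.
  (* The errors are less than [x e] and [e] from the two truncated integrals and at most [e] for
     each boundary value. *)
  set (e := eps / (x + 4)).
  assert (He : 0 < e) by (apply Rdiv_lt_0_compat; lra).
  assert (Hee : eps = (x + 4) * e) by (unfold e; field; lra).
  destruct (proj2 (Gamma_approx x Hx) e He) as (a1 & b1 & A1 & B1 & H1).
  destruct (proj2 (Gamma_approx (x + 1) ltac:(lra)) e He) as (a2 & b2 & A2 & B2 & H2).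
  set (K := exp ((x + 1) * ln (x + 1))).
  assert (HK : 0 < K) by apply exp_pos.
  (* The last argument of the minimum forces [a^x <= e]; that of the maximum forces
     [b^x exp (- b) <= K / b <= e]. *)
  set (a := Rmin (Rmin a1 a2) (Rpower e (/ x))).
  set (b := Rmax (Rmax b1 b2) (K / e)).
  assert (Ha : 0 < a).
  { unfold a. repeat apply Rmin_glb_lt; try assumption. apply exp_pos. }
  assert (Ha1 : a <= a1 /\ a <= a2 /\ a <= Rpower e (/ x)).
  { unfold a. pose proof (Rmin_l (Rmin a1 a2) (Rpower e (/ x))).
    pose proof (Rmin_r (Rmin a1 a2) (Rpower e (/ x))).
    pose proof (Rmin_l a1 a2). pose proof (Rmin_r a1 a2). lra. }
  assert (Hb1 : b1 <= b /\ b2 <= b /\ K / e <= b).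
  { unfold b. pose proof (Rmax_l (Rmax b1 b2) (K / e)). pose proof (Rmax_r (Rmax b1 b2) (K / e)).
    pose proof (Rmax_l b1 b2). pose proof (Rmax_r b1 b2). lra. }
  assert (Hab : a <= b) by lra.
  specialize (H1 a b Ha ltac:(lra) ltac:(lra)).
  specialize (H2 a b Ha ltac:(lra) ltac:(lra)).
  set (B := fun t => Rpower t x * exp (- t)).
  assert (HI : is_RInt (fun t => minus (scal x (gamma_integrand x t)) (gamma_integrand (x + 1) t)) a b
                 (minus (B b) (B a))).
  { apply (is_RInt_derive B); intros t Ht; rewrite Rmin_left in Ht by assumption.
    - unfold B, gamma_integrand, minus, plus, opp, scal; simpl; unfold mult; simpl.
      replace (x + 1 - 1) with x by ring.
      unfold Rminus. rewrite Rpower_plus, Rpower_Ropp, Rpower_1 by lra.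
      unfold Rpower. auto_derive; [lra|]. field. lra.
    - match goal with |- continuous ?f t => apply (ex_derive_continuous f) end.
      unfold gamma_integrand, minus, plus, opp, scal; simpl; unfold mult; simpl; unfold Rpower.
      auto_derive. lra. }
  assert (Eq : x * RInt (gamma_integrand x) a b - RInt (gamma_integrand (x + 1)) a b = B b - B a).
  { pose proof (is_RInt_minus _ _ _ _ _ _
      (is_RInt_scal _ _ _ x _ (RInt_correct _ _ _ (ex_RInt_gamma x a b Ha Hab)))
      (RInt_correct _ _ _ (ex_RInt_gamma (x + 1) a b Ha Hab))) as HI'.
    apply (is_RInt_unique (V := R_CompleteNormedModule)) in HI.
    apply (is_RInt_unique (V := R_CompleteNormedModule)) in HI'. exact (eq_trans (eq_sym HI') HI). }
  assert (Bb : 0 < B b <= e).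
  { assert (b0 : 0 < b) by lra. split; [apply Rmult_lt_0_compat; apply exp_pos|].
    pose proof (Rpower_exp_neg_bounded (x + 1) b ltac:(lra) b0) as Hk. fold K in Hk.
    rewrite Rpower_plus, Rpower_1 in Hk by assumption. unfold B.
    apply Rmult_le_reg_r with b; [assumption|].
    apply Rle_trans with K; [lra|].
    apply Rle_trans with (e * (K / e)); [right; field; lra|].
    apply Rmult_le_compat_l; lra. }
  assert (Ba : 0 < B a <= e).
  { split; [apply Rmult_lt_0_compat; apply exp_pos|]. unfold B.
    assert (Rpower a x <= e).
    { replace e with (Rpower (Rpower e (/ x)) x).
      - apply Rle_Rpower_l; lra.
      - rewrite Rpower_mult, Rinv_l, Rpower_1; lra. }
    assert (exp (- a) <= 1) by (left; rewrite <- exp_0; apply exp_increasing; lra).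
    pose proof (exp_pos (- a)). pose proof (exp_pos (x * ln a)). unfold Rpower in *. nra. }
  apply Rabs_def2 in H1. apply Rabs_def2 in H2.
  rewrite Hee. apply Rabs_def1; nra.
Qed.

(** [exp p] and [exp q] lie above the tangent at the mean [m], and the weighted average of the
    tangent values is [exp m]. *)
Lemma exp_convex (p q l : R) : 0 <= l <= 1 ->
  exp (l * p + (1 - l) * q) <= l * exp p + (1 - l) * exp q.
Proof.
  intros Hl. set (m := l * p + (1 - l) * q).
  assert (T : forall r, exp m * (1 + (r - m)) <= exp r).
  { intros r. replace (exp r) with (exp m * exp (r - m)) by (rewrite <- exp_plus; f_equal; ring).
    apply Rmult_le_compat_l; [left; apply exp_pos|].
    destruct (Req_dec (r - m) 0) as [->|H]; [rewrite exp_0; lra|]. left. now apply exp_ineq1. }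
  pose proof (T p). pose proof (T q).
  replace (exp m) with (l * (exp m * (1 + (p - m))) + (1 - l) * (exp m * (1 + (q - m)))) by (unfold m;
    ring).
  apply Rplus_le_compat; apply Rmult_le_compat_l; lra.
Qed.

(** This is Hölder's inequality: after dividing the integrands by [A] and [B], the convexity of
    [exp] compares them pointwise, and the integrated right-hand side is at most
    [E * (l + (1 - l))]. *)
Lemma ln_Gamma_convex (x y l : R) : 0 < x -> 0 < y -> 0 <= l <= 1 ->
  ln (Gamma (l * x + (1 - l) * y)) <= l * ln (Gamma x) + (1 - l) * ln (Gamma y).
Proof.
  intros Hx Hy Hl.
  set (z := l * x + (1 - l) * y).
  assert (Hz : 0 < z).
  { unfold z. destruct (Req_dec l 0) as [->|]; [lra|].
    assert (0 < l * x) by (apply Rmult_lt_0_compat; lra).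
    assert (0 <= (1 - l) * y) by (apply Rmult_le_pos; lra). lra. }
  set (A := Gamma x). set (B := Gamma y).
  assert (HA : 0 < A) by now apply Gamma_pos.
  assert (HB : 0 < B) by now apply Gamma_pos.
  set (E := exp (l * ln A + (1 - l) * ln B)).
  assert (HE : 0 < E) by apply exp_pos.
  rewrite <- (ln_exp (l * ln A + (1 - l) * ln B)). apply ln_le; [now apply Gamma_pos|].
  fold E. apply Gamma_le; [assumption|]. intros a b Ha Hab.
  apply Rle_trans with (RInt (fun t => plus (scal (E * l / A) (gamma_integrand x t)) (scal (E * (1
    - l) / B) (gamma_integrand y t))) a b).
  - apply RInt_le; [assumption | now apply ex_RInt_gamma | |].
    { apply (ex_RInt_plus (V := R_NormedModule)); apply (ex_RInt_scal (V := R_NormedModule));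
        now apply ex_RInt_gamma. }
    intros t Ht.
    unfold plus, scal; simpl; unfold mult; simpl.
    assert (F : forall w, gamma_integrand w t = exp ((w - 1) * ln t - t)).
    { intros w. unfold gamma_integrand, Rpower. rewrite <- exp_plus. reflexivity. }
    assert (G : forall w C, 0 < C -> gamma_integrand w t / C = exp ((w - 1) * ln t - t - ln C)).
    { intros w C HC. rewrite F. unfold Rminus at 3. rewrite exp_plus, exp_Ropp, exp_ln by assumption.
      reflexivity. }
    pose proof (exp_convex ((x - 1) * ln t - t - ln A) ((y - 1) * ln t - t - ln B) l Hl) as C.
    rewrite <- !G in C by assumption.
    apply (Rmult_le_compat_l E) in C; [|lra].
    replace (E * exp (l * ((x - 1) * ln t - t - ln A) + (1 - l) * ((y - 1) * ln t - t - ln B)))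
      with (gamma_integrand z t) in C.
    + unfold Rdiv in *. lra.
    + rewrite F. unfold E. rewrite <- exp_plus. f_equal. unfold z. ring.
  - rewrite (RInt_plus (V := R_CompleteNormedModule)) by (apply (ex_RInt_scal (V := R_NormedModule));
      now apply ex_RInt_gamma).
    rewrite !(RInt_scal (V := R_CompleteNormedModule)) by now apply ex_RInt_gamma.
    unfold plus, scal; simpl; unfold mult; simpl.
    pose proof (proj1 (Gamma_approx x Hx) a b Ha Hab) as HxI. fold A in HxI.
    pose proof (proj1 (Gamma_approx y Hy) a b Ha Hab) as HyI. fold B in HyI.
    apply Rle_trans with (E * l / A * A + E * (1 - l) / B * B).
    + apply Rplus_le_compat; apply Rmult_le_compat_l; try assumption;
        (apply Rmult_le_pos; [apply Rmult_le_pos; lra | left; now apply Rinv_0_lt_compat]).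
    + right. field. lra.
Qed.

(** * The digamma function as a limit *)

Fixpoint sum_lt (f : nat -> R) (N : nat) : R :=
  match N with O => 0 | S m => sum_lt f m + f m end.

Lemma ln_le_sub_1 (z : R) : 0 < z -> ln z <= z - 1.
Proof.
  intros Hz. destruct (Req_dec (ln z) 0) as [H|H].
  - rewrite H. apply (f_equal exp) in H. rewrite exp_ln, exp_0 in H by assumption. lra.
  - pose proof (exp_ineq1 _ H) as E. rewrite exp_ln in E by assumption. lra.
Qed.

Lemma ln_diff_le (y z : R) : 0 < y -> 0 < z -> ln z - ln y <= (z - y) / y.
Proof.
  intros Hy Hz. rewrite <- ln_div by assumption.
  replace ((z - y) / y) with (z / y - 1) by (field; lra).
  apply ln_le_sub_1. now apply Rdiv_lt_0_compat.
Qed.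

Lemma ln_Gamma_succ (y : R) : 0 < y -> ln (Gamma (y + 1)) = ln (Gamma y) + ln y.
Proof.
  intros Hy. rewrite Gamma_succ, ln_mult by (try apply Gamma_pos; assumption). ring.
Qed.

(* Convexity squeezes the increment between the chords over [[y - 1, y]] and [[y, y + 1]]. *)
Lemma ln_Gamma_increment (y h : R) : 1 < y -> -1 <= h <= 1 ->
  Rabs (ln (Gamma (y + h)) - ln (Gamma y) - h * ln y) <= Rabs h * (ln y - ln (y - 1)).
Proof.
  intros Hy Hh.
  pose proof (ln_Gamma_succ y ltac:(lra)) as S1.
  pose proof (ln_Gamma_succ (y - 1) ltac:(lra)) as S0.
  replace (y - 1 + 1) with y in S0 by ring.
  assert (Hln : ln (y - 1) < ln y) by (apply ln_increasing; lra).
  destruct (Rle_lt_dec 0 h) as [H|H].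
  - rewrite (Rabs_pos_eq h) by assumption.
    pose proof (ln_Gamma_convex (y + 1) y h ltac:(lra) ltac:(lra) ltac:(lra)) as C1.
    replace (h * (y + 1) + (1 - h) * y) with (y + h) in C1 by ring.
    (* The lower bound: [y] lies between [y - 1] and [y + h], with weight [1 / (1 + h)] on
       [y + h]. *)
    assert (Hl : 0 <= / (1 + h) <= 1).
    { split; [left; apply Rinv_0_lt_compat; lra|]. rewrite <- Rinv_1. apply Rinv_le_contravar; lra. }
    pose proof (ln_Gamma_convex (y + h) (y - 1) (/ (1 + h)) ltac:(lra) ltac:(lra) Hl) as C2.
    replace (/ (1 + h) * (y + h) + (1 - / (1 + h)) * (y - 1)) with y in C2 by (field; lra).
    apply (Rmult_le_compat_l (1 + h)) in C2; [|lra].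
    replace ((1 + h) * (/ (1 + h) * ln (Gamma (y + h)) + (1 - / (1 + h)) * ln (Gamma (y - 1))))
      with (ln (Gamma (y + h)) + h * ln (Gamma (y - 1))) in C2 by (field; lra).
    apply Rabs_le. rewrite S1 in C1. rewrite S0 in *. split; nra.
  - rewrite (Rabs_left h) by assumption.
    pose proof (ln_Gamma_convex (y - 1) y (- h) ltac:(lra) ltac:(lra) ltac:(lra)) as C1.
    replace (- h * (y - 1) + (1 - - h) * y) with (y + h) in C1 by ring.
    assert (Hl : 0 <= / (1 - h) <= 1).
    { split; [left; apply Rinv_0_lt_compat; lra|]. rewrite <- Rinv_1. apply Rinv_le_contravar; lra. }
    pose proof (ln_Gamma_convex (y + h) (y + 1) (/ (1 - h)) ltac:(lra) ltac:(lra) Hl) as C2.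
    replace (/ (1 - h) * (y + h) + (1 - / (1 - h)) * (y + 1)) with y in C2 by (field; lra).
    apply (Rmult_le_compat_l (1 - h)) in C2; [|lra].
    replace ((1 - h) * (/ (1 - h) * ln (Gamma (y + h)) + (1 - / (1 - h)) * ln (Gamma (y + 1))))
      with (ln (Gamma (y + h)) - h * ln (Gamma (y + 1))) in C2 by (field; lra).
    apply Rabs_le. rewrite S1 in C2. rewrite S0 in *. split; nra.
Qed.

Lemma ln_Gamma_shift (x : R) (N : nat) : 0 < x ->
  ln (Gamma (x + INR N)) = ln (Gamma x) + sum_lt (fun k => ln (x + INR k)) N.
Proof.
  intros Hx. induction N as [|N IH]; [simpl; rewrite Rplus_0_r; ring|].
  rewrite S_INR, <- Rplus_assoc, ln_Gamma_succ, IH by (pose proof (pos_INR N); lra).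
  simpl. ring.
Qed.

Definition digamma_approx (x : R) (N : nat) : R :=
  ln (x + INR N) - sum_lt (fun k => / (x + INR k)) N.

Lemma is_derive_sum_ln (x : R) (N : nat) : 0 < x ->
  is_derive (fun z => sum_lt (fun k => ln (z + INR k)) N) x (sum_lt (fun k => / (x + INR k)) N).
Proof.
  intros Hx. induction N as [|N IH]; simpl.
  - apply (is_derive_const (V := R_NormedModule)).
  - apply (is_derive_plus (V := R_NormedModule)); [exact IH|].
    pose proof (pos_INR N). auto_derive; [lra|]. field. lra.
Qed.

Lemma digamma_approx_decr (x : R) (N : nat) : 0 < x ->
  digamma_approx x (S N) <= digamma_approx x N.
Proof.
  intros Hx. unfold digamma_approx; cbn [sum_lt]. rewrite S_INR. pose proof (pos_INR N).
  pose proof (ln_diff_le (x + INR N) (x + (INR N + 1)) ltac:(lra) ltac:(lra)) as H1.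
  replace ((x + (INR N + 1) - (x + INR N)) / (x + INR N)) with (/ (x + INR N)) in H1 by (field; lra).
  lra.
Qed.

(** The error factor of [ln_Gamma_increment] at [y = x + N]; it also serves as the width of the
    intervals enclosing the digamma value. *)
Definition digamma_gap (x : R) (N : nat) : R := ln (x + INR N) - ln (x + INR N - 1).

Lemma digamma_lower_incr (x : R) (N : nat) : 1 < x + INR N ->
  digamma_approx x N - digamma_gap x N <= digamma_approx x (S N) - digamma_gap x (S N).
Proof.
  intros Hx. unfold digamma_approx, digamma_gap; cbn [sum_lt]. rewrite S_INR.
  replace (x + (INR N + 1) - 1) with (x + INR N) by ring.
  pose proof (ln_diff_le (x + INR N) (x + INR N - 1) ltac:(lra) ltac:(lra)) as H1.
  replace ((x + INR N - 1 - (x + INR N)) / (x + INR N)) with (- / (x + INR N)) in H1 by (field; lra).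
  lra.
Qed.

Lemma digamma_gap_bound (x : R) (N : nat) : 0 < x -> (2 <= N)%nat ->
  0 <= digamma_gap x N <= / (INR N - 1).
Proof.
  intros Hx HN. apply le_INR in HN. simpl in HN. unfold digamma_gap. split.
  - assert (ln (x + INR N - 1) < ln (x + INR N)) by (apply ln_increasing; lra). lra.
  - eapply Rle_trans; [apply ln_diff_le; lra|].
    replace (x + INR N - (x + INR N - 1)) with 1 by ring. unfold Rdiv. rewrite Rmult_1_l.
    apply Rinv_le_contravar; lra.
Qed.

(** Nested intervals: the upper ends decrease and the lower ends increase. The common point is
    identified with [digamma x] only later, once [ln Gamma] has been differentiated. *)
Lemma digamma_approx_lim (x : R) : 0 < x ->
  exists L, forall N, (2 <= N)%nat ->
    digamma_approx x N - digamma_gap x N <= L <= digamma_approx x N.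
Proof.
  intros Hx.
  assert (HD : forall N M, (N <= M)%nat -> digamma_approx x M <= digamma_approx x N).
  { intros N M H. induction H; [lra|]. eapply Rle_trans; [now apply digamma_approx_decr|assumption]. }
  assert (HI : forall N M, (2 <= N)%nat -> (N <= M)%nat ->
    digamma_approx x N - digamma_gap x N <= digamma_approx x M - digamma_gap x M).
  { intros N M H2 H. induction H; [lra|]. eapply Rle_trans; [exact IHle|].
    apply digamma_lower_incr. assert (2 <= m)%nat as Hm by lia. apply le_INR in Hm. simpl in Hm. lra. }
  destruct (completeness (fun r => exists N, (2 <= N)%nat /\ r = digamma_approx x N
    - digamma_gap x N)) as [L [L1 L2]].
  - exists (digamma_approx x 2). intros r (N & HN & ->).
    pose proof (digamma_gap_bound x N Hx HN). specialize (HD 2%nat N HN). lra.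
  - exists (digamma_approx x 2 - digamma_gap x 2), 2%nat. now split.
  - exists L. intros N HN. split.
    + apply L1. now exists N.
    + apply L2. intros r (M & HM & ->).
      set (K := Nat.max N M).
      specialize (HI M K HM ltac:(lia)). specialize (HD N K ltac:(lia)).
      pose proof (digamma_gap_bound x K Hx ltac:(lia)). lra.
Qed.

Lemma inv_pred_INR_small (eps : R) : 0 < eps -> exists N, (2 <= N)%nat /\ / (INR N - 1) < eps.
Proof.
  intros He. destruct (nfloor_ex (/ eps)) as [m Hm]; [left; now apply Rinv_0_lt_compat|].
  exists (m + 2)%nat. split; [lia|]. rewrite plus_INR. simpl.
  rewrite <- (Rinv_inv eps). apply Rinv_lt_contravar; [|lra].
  pose proof (Rinv_0_lt_compat _ He). pose proof (pos_INR m). apply Rmult_lt_0_compat; lra.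
Qed.

(** Shifting the argument by [N] turns the difference quotient into that of [ln Gamma] at [x + N]
    minus that of a finite sum of logarithms. The first is within the gap of [ln (x + N)] uniformly
    in [h], because the bound on the increment is proportional to [|h|]; hence [N] can be fixed
    before [h]. *)
Lemma is_derive_ln_Gamma (x L : R) : 0 < x ->
  (forall N, (2 <= N)%nat -> digamma_approx x N - digamma_gap x N <= L <= digamma_approx x N) ->
  is_derive (fun z => ln (Gamma z)) x L.
Proof.
  intros Hx HL. apply is_derive_Reals. intros eps Heps.
  destruct (inv_pred_INR_small (eps / 4) ltac:(lra)) as (N & HN & HNe).
  pose proof (digamma_gap_bound x N Hx HN) as Hg. specialize (HL N HN).
  pose proof (is_derive_sum_ln x N Hx) as HS. apply is_derive_Reals in HS.
  destruct (HS (eps / 4) ltac:(lra)) as [d Hd].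
  assert (Hd' : 0 < Rmin d (Rmin 1 x)).
  { repeat apply Rmin_glb_lt; try lra. apply cond_pos. }
  exists (mkposreal _ Hd'). simpl. intros h Hh0 Hh.
  assert (Hh1 : Rabs h < d /\ Rabs h < 1 /\ Rabs h < x).
  { pose proof (Rmin_l d (Rmin 1 x)). pose proof (Rmin_r d (Rmin 1 x)).
    pose proof (Rmin_l 1 x). pose proof (Rmin_r 1 x). lra. }
  specialize (Hd h Hh0 (proj1 Hh1)).
  assert (Hhx : - x < h < x /\ -1 < h < 1).
  { destruct Hh1 as (_ & A & B). apply Rabs_def2 in A. apply Rabs_def2 in B. lra. }
  assert (HN2 : 2 <= INR N) by (apply le_INR in HN; simpl in HN; lra).
  pose proof (ln_Gamma_increment (x + INR N) h ltac:(lra) ltac:(lra)) as HI.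
  fold (digamma_gap x N) in HI.
  replace (x + INR N + h) with (x + h + INR N) in HI by ring.
  rewrite !ln_Gamma_shift in HI by lra.
  set (s1 := sum_lt (fun k => ln (x + h + INR k)) N) in *.
  set (s0 := sum_lt (fun k => ln (x + INR k)) N) in *.
  unfold digamma_approx in HL.
  set (s := sum_lt (fun k => / (x + INR k)) N) in *.
  set (l := ln (x + INR N)) in *.
  set (g := digamma_gap x N) in *.
  set (f1 := ln (Gamma (x + h))) in *. set (f0 := ln (Gamma x)) in *.
  assert (E : (f1 - f0) / h - L =
    (f1 + s1 - (f0 + s0) - h * l) / h - ((s1 - s0) / h - s) + (l - s - L)) by (field; assumption).
  assert (E1 : Rabs ((f1 + s1 - (f0 + s0) - h * l) / h) <= g).
  { unfold Rdiv. rewrite Rabs_mult, Rabs_inv.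
    pose proof (Rabs_pos_lt h Hh0).
    apply Rmult_le_reg_r with (Rabs h); [assumption|].
    rewrite Rmult_assoc, Rinv_l, Rmult_1_r by lra. lra. }
  rewrite E. apply Rabs_le_between in E1. apply Rabs_def2 in Hd.
  apply Rabs_def1; lra.
Qed.

Lemma digamma_bounds (x : R) (N : nat) : 0 < x -> (2 <= N)%nat ->
  digamma_approx x N - digamma_gap x N <= digamma x <= digamma_approx x N.
Proof.
  intros Hx HN. destruct (digamma_approx_lim x Hx) as [L HL].
  enough (E : digamma x = L) by (rewrite E; now apply HL).
  unfold digamma.
  assert (HD : is_derive Gamma x (Gamma x * L)).
  { apply (is_derive_ext_loc (fun z => exp (ln (Gamma z)))).
    - exists (mkposreal x Hx). intros y Hy. apply exp_ln, Gamma_pos.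
      unfold ball in Hy; simpl in Hy; unfold AbsRing_ball, abs, minus, plus, opp in Hy; simpl in Hy.
      apply Rabs_def2 in Hy. lra.
    - pose proof (is_derive_ln_Gamma x L Hx HL) as H1.
      pose proof (is_derive_exp (ln (Gamma x))) as H2.
      pose proof (is_derive_comp exp (fun z => ln (Gamma z)) x _ _ H2 H1) as H3.
      rewrite exp_ln in H3 by now apply Gamma_pos.
      unfold scal in H3; simpl in H3; unfold mult in H3; simpl in H3.
      rewrite Rmult_comm in H3. exact H3. }
  rewrite (is_derive_unique _ _ _ HD). field. apply Rgt_not_eq, Gamma_pos, Hx.
Qed.

Lemma is_lim_seq_inv_pred : is_lim_seq (fun N => / (INR N - 1)) 0.
Proof.
  apply (is_lim_seq_inv _ p_infty); [|discriminate].
  apply (is_lim_seq_minus _ _ p_infty 1); [apply is_lim_seq_INR | apply is_lim_seq_const | reflexivity].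
Qed.

Lemma is_lim_seq_digamma (x : R) : 0 < x -> is_lim_seq (digamma_approx x) (digamma x).
Proof.
  intros Hx.
  apply (is_lim_seq_le_le_loc (fun _ => digamma x) _ (fun N => digamma x + / (INR N - 1))).
  - exists 2%nat. intros N HN.
    pose proof (digamma_bounds x N Hx HN). pose proof (digamma_gap_bound x N Hx HN). lra.
  - apply is_lim_seq_const.
  - replace (Finite (digamma x)) with (Finite (digamma x + 0)) by (f_equal; ring).
    apply is_lim_seq_plus'; [apply is_lim_seq_const | apply is_lim_seq_inv_pred].
Qed.

Lemma sum_lt_ext (f g : nat -> R) (N : nat) :
  (forall k, (k < N)%nat -> f k = g k) -> sum_lt f N = sum_lt g N.
Proof.
  induction N as [|N IH]; intros H; [reflexivity|]. cbn [sum_lt].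
  rewrite IH by (intros; apply H; lia). now rewrite H by lia.
Qed.

Lemma sum_lt_lin (f g : nat -> R) (a b : R) (N : nat) :
  sum_lt (fun k => a * f k + b * g k) N = a * sum_lt f N + b * sum_lt g N.
Proof.
  induction N as [|N IH]; cbn [sum_lt]; [ring|]. rewrite IH. ring.
Qed.

Lemma sum_lt_pairs (f : nat -> R) (N : nat) :
  sum_lt f (2 * N) = sum_lt (fun j => f (2 * j)%nat + f (S (2 * j))) N.
Proof.
  induction N as [|N IH]; [reflexivity|].
  replace (2 * S N)%nat with (S (S (2 * N))) by lia. cbn [sum_lt]. rewrite IH. ring.
Qed.

Lemma is_lim_seq_ln_shift (a b : R) : 0 < a -> 0 < b ->
  is_lim_seq (fun N => ln (b + INR N) - ln (a + INR N)) 0.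
Proof.
  intros Ha Hb.
  assert (HL : forall c d : R, is_lim_seq (fun N => d / (c + INR N)) 0).
  { intros c d. replace (Finite 0) with (Rbar_mult d 0) by (simpl; f_equal; ring).
    apply is_lim_seq_scal_l.
    apply (is_lim_seq_inv _ p_infty); [|discriminate].
    apply (is_lim_seq_plus _ _ c p_infty);
      [apply is_lim_seq_const | apply is_lim_seq_INR | reflexivity]. }
  apply (is_lim_seq_le_le (fun N => (b - a) / (b + INR N)) _ (fun N => (b - a) / (a + INR N)));
    try apply HL.
  intros N. pose proof (pos_INR N).
  pose proof (ln_diff_le (a + INR N) (b + INR N) ltac:(lra) ltac:(lra)) as H1.
  pose proof (ln_diff_le (b + INR N) (a + INR N) ltac:(lra) ltac:(lra)) as H2.
  replace ((b + INR N - (a + INR N)) / (a + INR N)) with ((b - a) / (a + INR N)) in H1 by (field; lra).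
  replace ((a + INR N - (b + INR N)) / (b + INR N)) with (- ((b - a) / (b + INR N))) in H2 by (field;
    lra).
  lra.
Qed.

Lemma is_lim_seq_digamma_diff (a b : R) : 0 < a -> 0 < b ->
  is_lim_seq (sum_lt (fun k => / (a + INR k) - / (b + INR k))) (digamma b - digamma a).
Proof.
  intros Ha Hb.
  apply (is_lim_seq_ext (fun N => (digamma_approx b N - digamma_approx a N) - (ln (b + INR N) - ln (a
    + INR N)))).
  - intros N. unfold digamma_approx.
    rewrite (sum_lt_ext (fun k => / (a + INR k) - / (b + INR k)) (fun k => 1 * / (a + INR k)
      + (-1) * / (b + INR k)))
      by (intros; ring).
    rewrite (sum_lt_lin (fun k => / (a + INR k)) (fun k => / (b + INR k))). ring.
  - replace (digamma b - digamma a) with ((digamma b - digamma a) - 0) by ring.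
    apply is_lim_seq_minus'; [apply is_lim_seq_minus'; now apply is_lim_seq_digamma|].
    now apply is_lim_seq_ln_shift.
Qed.

(** The first [2 N] reciprocals at [2 x] split by parity into half the sums at [x] and at [x + 1/2].
    The term [ln 2] comes from [ln (2 (x + N))]. *)
Lemma digamma_duplication (x : R) : 0 < x ->
  digamma (2 * x) = / 2 * digamma x + / 2 * digamma (x + / 2) + ln 2.
Proof.
  intros Hx.
  assert (H1 : is_lim_seq (fun N => digamma_approx (2 * x) (2 * N)) (digamma (2 * x))).
  { apply (is_lim_seq_subseq (digamma_approx (2 * x)) _ (fun N => (2 * N)%nat)).
    - apply eventually_subseq. intros; lia.
    - apply is_lim_seq_digamma. lra. }
  assert (H2 : is_lim_seq (fun N => digamma_approx (2 * x) (2 * N))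
    (/ 2 * digamma x + / 2 * digamma (x + / 2) + (ln 2 + / 2 * 0))).
  { apply (is_lim_seq_ext (fun N => / 2 * digamma_approx x N + / 2 * digamma_approx (x + / 2) N
             + (ln 2 + / 2 * (ln (x + INR N) - ln (x + / 2 + INR N))))).
    - intros N. unfold digamma_approx. rewrite sum_lt_pairs.
      rewrite (sum_lt_ext (fun j => / (2 * x + INR (2 * j)) + / (2 * x + INR (S (2 * j))))
        (fun j => / 2 * / (x + INR j) + / 2 * / (x + / 2 + INR j))).
      + rewrite (sum_lt_lin (fun j => / (x + INR j)) (fun j => / (x + / 2 + INR j))).
        rewrite mult_INR. change (INR 2) with 2.
        replace (2 * x + 2 * INR N) with (2 * (x + INR N)) by ring.
        pose proof (pos_INR N). rewrite (ln_mult 2) by lra. field.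
      + intros k _. rewrite S_INR, mult_INR. change (INR 2) with 2. pose proof (pos_INR k). field. lra.
    - repeat apply is_lim_seq_plus'; try apply is_lim_seq_const;
        apply (is_lim_seq_scal_l _ (/ 2) (Finite _)).
      + now apply is_lim_seq_digamma.
      + apply is_lim_seq_digamma. lra.
      + apply is_lim_seq_ln_shift; lra. }
  apply is_lim_seq_unique in H1. apply is_lim_seq_unique in H2. rewrite H1 in H2.
  injection H2 as ->. ring.
Qed.

(** * Digamma differences as integrals *)

Lemma RInt_lin (f g : R -> R) (x y a b : R) :
  ex_RInt f a b -> ex_RInt g a b ->
  RInt (fun t => x * f t + y * g t) a b = x * RInt f a b + y * RInt g a b.
Proof.
  intros Hf Hg. apply (is_RInt_unique (V := R_CompleteNormedModule)).
  apply (is_RInt_plus (V := R_NormedModule)); apply (is_RInt_scal (V := R_NormedModule));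
    now apply (RInt_correct (V := R_CompleteNormedModule)).
Qed.

Lemma RInt_scal_l (f : R -> R) (x a b : R) :
  ex_RInt f a b -> RInt (fun t => x * f t) a b = x * RInt f a b.
Proof.
  intros Hf. exact (RInt_scal (V := R_CompleteNormedModule) f a b x Hf).
Qed.

Lemma RInt_01_pow (k : nat) : RInt (fun t => t ^ k) 0 1 = / (INR k + 1).
Proof.
  apply (is_RInt_unique (V := R_CompleteNormedModule)).
  pose proof (pos_INR k).
  replace (/ (INR k + 1)) with (minus (1 ^ S k / (INR k + 1)) (0 ^ S k / (INR k + 1))).
  - apply (is_RInt_derive (fun t => t ^ S k / (INR k + 1)) (fun t => t ^ k)); intros t _.
    + auto_derive; [trivial|]. destruct k; simpl in *; field; lra.
    + apply (ex_derive_continuous (fun t => t ^ k)). now auto_derive.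
  - unfold minus, plus, opp; simpl. rewrite pow1. field. lra.
Qed.

(** The quotient [geom d s / geom m s] is [(1 - s^d) / (1 - s^m)] without the singularity at
    [s = 1], so that it is an ordinary integrand on [[0, 1]]. *)
Definition geom (d : nat) (s : R) : R := sum_lt (fun j => s ^ j) d.

Lemma geom_telescope (d : nat) (s : R) : (1 - s) * geom d s = 1 - s ^ d.
Proof.
  unfold geom. induction d as [|d IH]; cbn [sum_lt pow]; [ring|].
  rewrite Rmult_plus_distr_l, IH. ring.
Qed.

Lemma geom_ge_1 (d : nat) (s : R) : (1 <= d)%nat -> 0 <= s -> 1 <= geom d s.
Proof.
  intros Hd Hs. unfold geom. induction Hd as [|d Hd IH]; cbn [sum_lt]; [simpl; lra|].
  pose proof (pow_le s d Hs). lra.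
Qed.

Lemma pow_le_1 (s : R) (k : nat) : 0 <= s <= 1 -> 0 <= s ^ k <= 1.
Proof.
  intros Hs. split; [now apply pow_le|]. rewrite <- (pow1 k). now apply pow_incr.
Qed.

Lemma geom_le (d : nat) (s : R) : 0 <= s <= 1 -> 0 <= geom d s <= INR d.
Proof.
  intros Hs. unfold geom. induction d as [|d IH]; cbn [sum_lt]; [simpl; lra|].
  rewrite S_INR. pose proof (pow_le_1 s d Hs). lra.
Qed.

Lemma ex_derive_geom (d : nat) (s : R) : ex_derive (geom d) s.
Proof.
  unfold geom. induction d as [|d IH]; cbn [sum_lt].
  - apply (ex_derive_const (V := R_NormedModule)).
  - apply (ex_derive_plus (V := R_NormedModule)); [exact IH|]. now auto_derive.
Qed.

Ltac ex_int01 := apply ex_RInt_of_derive; intros ?t ?Ht;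
  rewrite Rmin_left, Rmax_right in * by lra; auto_derive; trivial.

Lemma ex_RInt_geom_quot (q d m : nat) : (1 <= m)%nat ->
  ex_RInt (fun s => s ^ q * (geom d s / geom m s)) 0 1.
Proof.
  intros Hm. ex_int01. pose proof (geom_ge_1 m t Hm ltac:(lra)).
  repeat split; try apply ex_derive_geom. lra.
Qed.

(** The [k]-th term of the digamma difference is [m] times the integral of [s^(q + m k) (1 - s^d)].
    Since [1 - s^d = (1 - s^m) * geom d s / geom m s], the terms telescope to
    [m (I q - I (q + m N))]. *)
Lemma digamma_diff_RInt (q d m : nat) : (1 <= m)%nat ->
  digamma ((INR q + 1 + INR d) / INR m) - digamma ((INR q + 1) / INR m)
  = INR m * RInt (fun s => s ^ q * (geom d s / geom m s)) 0 1.
Proof.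
  intros Hm.
  assert (Hm1 : 1 <= INR m) by (apply le_INR in Hm; exact Hm).
  pose proof (pos_INR q) as Hq. pose proof (pos_INR d) as Hd.
  set (a := (INR q + 1) / INR m). set (b := (INR q + 1 + INR d) / INR m).
  assert (Ha : 0 < a) by (apply Rdiv_lt_0_compat; lra).
  assert (Hb : 0 < b) by (apply Rdiv_lt_0_compat; lra).
  set (I := fun j => RInt (fun s => s ^ j * (geom d s / geom m s)) 0 1).
  fold (I q).
  assert (HS : forall N, sum_lt (fun k => / (a + INR k) - / (b + INR k)) N
                 = INR m * (I q - I (q + m * N)%nat)).
  { induction N as [|N IH]; cbn [sum_lt].
    - rewrite Nat.mul_0_r, Nat.add_0_r. ring.
    - rewrite IH. clear IH.
      assert (E : I (q + m * N)%nat - I (q + m * S N)%nat = / (INR (q + m * N) + 1) - / (INR (q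
        + m * N + d) + 1)).
      { rewrite <- !RInt_01_pow. unfold I.
        transitivity (RInt (fun s => 1 * (s ^ (q + m * N) * (geom d s / geom m s)) + (-1) * (s ^ (q
          + m * S N) * (geom d s / geom m s))) 0 1).
        { rewrite RInt_lin by now apply ex_RInt_geom_quot. ring. }
        transitivity (RInt (fun s => 1 * s ^ (q + m * N) + (-1) * s ^ (q + m * N + d)) 0 1).
        2: { rewrite RInt_lin by ex_int01. ring. }
        apply RInt_ext. rewrite Rmin_left, Rmax_right by lra. intros s Hs.
        pose proof (geom_ge_1 m s Hm ltac:(lra)) as Hg.
        replace (q + m * S N)%nat with (q + m * N + m)%nat by ring.
        rewrite !(pow_add s (q + m * N)).
        pose proof (geom_telescope m s) as T1. pose proof (geom_telescope d s) as T2.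
        replace (s ^ m) with (1 - (1 - s) * geom m s) by lra.
        replace (s ^ d) with (1 - (1 - s) * geom d s) by lra.
        simpl. field. lra. }
      transitivity (INR m * (I q - I (q + m * N)%nat) + INR m * (I (q + m * N)%nat - I (q
        + m * S N)%nat)); [|ring].
      f_equal. rewrite E, !plus_INR, mult_INR. pose proof (pos_INR N).
      assert (0 <= INR m * INR N) by (apply Rmult_le_pos; lra).
      unfold a, b. field. repeat split; nra. }
  assert (HL : is_lim_seq (fun N => INR m * (I q - I (q + m * N)%nat)) (INR m * (I q - 0))).
  { apply (is_lim_seq_scal_l _ (INR m) (Finite _)). apply is_lim_seq_minus'; [apply is_lim_seq_const|].
    (* The quotient of [geom]s is at most [d] on [[0, 1]], and [s^(q + m N) <= s^N] integrates to at
       most [1 / (N + 1)]. *)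
    apply (is_lim_seq_le_le (fun _ => 0) _ (fun N => INR d * / INR (S N))).
    - intros N. split.
      + apply RInt_ge_0; [lra | now apply ex_RInt_geom_quot |]. intros s Hs.
        apply Rmult_le_pos; [apply pow_le; lra|].
        pose proof (geom_ge_1 m s Hm ltac:(lra)). pose proof (geom_le d s ltac:(lra)).
        apply Rmult_le_pos; [lra|]. left. apply Rinv_0_lt_compat. lra.
      + rewrite S_INR, <- RInt_01_pow, <- RInt_scal_l by ex_int01.
        apply RInt_le; [lra | now apply ex_RInt_geom_quot | ex_int01 |].
        intros s Hs.
        pose proof (geom_ge_1 m s Hm ltac:(lra)) as Hg. pose proof (geom_le d s ltac:(lra)) as Hg2.
        assert (P1 : s ^ (q + m * N) <= s ^ N).
        { replace (q + m * N)%nat with (N + (q + (m - 1) * N))%nat by nia.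
          rewrite pow_add. pose proof (pow_le_1 s N ltac:(lra)).
          pose proof (pow_le_1 s (q + (m - 1) * N) ltac:(lra)). nra. }
        assert (P2 : 0 <= geom d s / geom m s <= INR d).
        { split.
          - apply Rmult_le_pos; [lra|]. left. apply Rinv_0_lt_compat. lra.
          - apply Rmult_le_reg_r with (geom m s); [lra|]. unfold Rdiv.
            rewrite Rmult_assoc, Rinv_l by lra. nra. }
        rewrite Rmult_comm. apply Rmult_le_compat; try lra. apply pow_le; lra.
    - apply is_lim_seq_const.
    - replace (Finite 0) with (Rbar_mult (INR d) 0) by (simpl; f_equal; ring).
      apply is_lim_seq_scal_l. apply (is_lim_seq_incr_1 (fun N => / INR N)).
      apply (is_lim_seq_inv _ p_infty); [apply is_lim_seq_INR | discriminate]. }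
  pose proof (is_lim_seq_digamma_diff a b Ha Hb) as HD.
  apply (is_lim_seq_ext _ _ _ HS) in HD.
  apply is_lim_seq_unique in HL. apply is_lim_seq_unique in HD. rewrite HL in HD.
  injection HD as HD. rewrite <- HD. ring.
Qed.

Definition beta_kernel (n j : nat) (s : R) : R := s ^ j * (1 - s ^ 2) / (1 + s ^ n).

Lemma one_plus_pow_pos (n : nat) (s : R) : 0 <= s -> 1 <= 1 + s ^ n.
Proof. intros Hs. pose proof (pow_le s n Hs). lra. Qed.

Lemma geom_double (n : nat) (s : R) : geom (2 * n) s = geom n s * (1 + s ^ n).
Proof.
  replace (2 * n)%nat with (n + n)%nat by lia.
  enough (H : forall m, geom (n + m) s = geom n s + s ^ n * geom m s) by (rewrite H; ring).
  unfold geom. induction m as [|m IH]; [rewrite Nat.add_0_r; cbn [sum_lt]; ring|].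
  rewrite Nat.add_succ_r. cbn [sum_lt]. rewrite IH, pow_add. ring.
Qed.

Lemma ex_RInt_beta_kernel (n j : nat) : ex_RInt (beta_kernel n j) 0 1.
Proof.
  unfold beta_kernel. ex_int01. pose proof (one_plus_pow_pos n t ltac:(lra)). lra.
Qed.

(** Both digamma differences have step [2], one with denominator [n] and one with [2 n]. As
    [geom (2 n)] is [geom n] times [1 + s^n], they combine through [1 - 2 / (1 + s^n) = - (1 - s^n)
    / (1 + s^n)], whose numerator cancels [geom n]. *)
Lemma psi_coef_RInt (n j : nat) : (1 <= n)%nat ->
  psi_coef n (j + 2) = - INR n * RInt (beta_kernel n j) 0 1.
Proof.
  intros Hn.
  assert (Hn1 : 1 <= INR n) by (apply le_INR in Hn; exact Hn).
  unfold psi_coef.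
  pose proof (digamma_diff_RInt j 2 n Hn) as H1.
  pose proof (digamma_diff_RInt j 2 (2 * n) ltac:(lia)) as H2.
  rewrite mult_INR in H2. change (INR 2) with 2 in *.
  rewrite plus_INR. change (INR 2) with 2.
  replace (INR j + 2 - 1) with (INR j + 1) by ring.
  replace (INR j + 2 + 1) with (INR j + 1 + 2) by ring.
  match goal with |- ?a - ?b - ?c + ?d = _ => transitivity ((d - c) - (b - a)); [ring|] end.
  rewrite H1, H2.
  transitivity (INR n * RInt (fun s => 1 * (s ^ j * (geom 2 s / geom n s))
    + (-2) * (s ^ j * (geom 2 s / geom (2 * n) s))) 0 1).
  { rewrite RInt_lin by (apply ex_RInt_geom_quot; lia). ring. }
  transitivity (INR n * RInt (fun s => -1 * beta_kernel n j s) 0 1).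
  2: { rewrite RInt_scal_l by apply ex_RInt_beta_kernel. ring. }
  f_equal. apply RInt_ext. rewrite Rmin_left, Rmax_right by lra. intros s Hs.
  rewrite geom_double. unfold beta_kernel.
  pose proof (geom_ge_1 n s Hn ltac:(lra)). pose proof (one_plus_pow_pos n s ltac:(lra)).
  pose proof (geom_telescope n s) as T.
  replace (geom 2 s) with (1 + s) by (unfold geom; simpl; ring).
  apply Rmult_eq_reg_r with (geom n s * (1 + s ^ n)); [|apply Rmult_integral_contrapositive; split; lra].
  transitivity (s ^ j * (1 + s) * (s ^ n - 1)); [field; lra|].
  transitivity (- s ^ j * (1 + s) * ((1 - s) * geom n s)); [rewrite T; ring | field; lra].
Qed.

(* [RInt_ext] leaves equations stated in a normed module, which [field] does not recognise. *)
Ltac as_R := match goal with |- ?a = ?b => change (@eq R a b) end.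

(** * Summing the series under the integral *)

(** For [c = cos t] this is [|1 - s exp (i t)|^2], the common denominator of the power sums with
    coefficients [cos (j t)] and [sin (j t)]. *)
Definition Qpoly (c s : R) : R := 1 - 2 * c * s + s ^ 2.

Lemma Qpoly_lower (c s : R) : -1 <= c < 1 -> 0 <= s -> (1 - c) / 2 <= Qpoly c s.
Proof.
  intros Hc Hs. unfold Qpoly.
  replace (1 - 2 * c * s + s ^ 2) with ((1 - s) ^ 2 + 2 * s * (1 - c)) by ring.
  pose proof (pow2_ge_0 (1 - s)). nra.
Qed.

Lemma cos_lt_1 (t : R) : 0 < t < 2 * PI -> -1 <= cos t < 1.
Proof.
  intros Ht. pose proof (COS_bound t). split; [lra|].
  replace t with (2 * (t / 2)) by field. rewrite cos_2a_sin.
  pose proof (sin_gt_0 (t / 2) ltac:(lra) ltac:(lra)). nra.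
Qed.

(** The integrand is the derivative of [ln Q / 2], and [Q] goes from [1] at [s = 0] to
    [(2 sin (t / 2))^2] at [s = 1]. *)
Lemma RInt_log_kernel (t : R) : 0 < t < 2 * PI ->
  RInt (fun s => (s - cos t) / Qpoly (cos t) s) 0 1 = ln (2 * sin (t / 2)).
Proof.
  intros Ht. pose proof (cos_lt_1 t Ht) as Hc. set (c := cos t) in *.
  assert (HQ : forall s, 0 <= s -> 0 < Qpoly c s) by (intros s Hs; pose proof (Qpoly_lower c s Hc Hs);
    lra).
  assert (Hs : 0 < sin (t / 2)) by (apply sin_gt_0; lra).
  assert (E : Qpoly c 1 = (2 * sin (t / 2)) * (2 * sin (t / 2))).
  { unfold Qpoly, c. replace t with (2 * (t / 2)) at 1 by field. rewrite cos_2a_sin. ring. }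
  apply (is_RInt_unique (V := R_CompleteNormedModule)).
  replace (ln (2 * sin (t / 2))) with (minus (/ 2 * ln (Qpoly c 1)) (/ 2 * ln (Qpoly c 0))).
  - apply (is_RInt_derive (fun s => / 2 * ln (Qpoly c s)) (fun s => (s - c) / Qpoly c s)); intros s Hs0;
      rewrite Rmin_left, Rmax_right in Hs0 by lra; specialize (HQ s ltac:(lra)); unfold Qpoly in *.
    + auto_derive; [lra|]. field. lra.
    + apply (ex_derive_continuous (fun s => (s - c) / (1 - 2 * c * s + s ^ 2))). auto_derive. lra.
  - rewrite E, ln_mult by lra. unfold minus, plus, opp, Qpoly; simpl.
    replace (1 - 2 * c * 0 + 0 * (0 * 1)) with 1 by ring. rewrite ln_1. field.
Qed.

(** A direct use of [digamma_diff_RInt] would give the denominator [1 - s^n]. The duplication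
    formula produces [1 + s^n] instead: the half step from [1/n] to [1/n + 1/2] gives the term in
    [s], and [ln 2] gives the term in [s^(n - 1)]. *)
Lemma digamma_two_one_RInt (n : nat) : (1 <= n)%nat ->
  digamma (2 / INR n) - digamma (1 / INR n)
  = INR n * RInt (fun s => (s + s ^ (n - 1)) / (1 + s ^ n)) 0 1.
Proof.
  intros Hn.
  assert (Hn1 : 1 <= INR n) by (apply le_INR in Hn; exact Hn).
  assert (HP : forall s, 0 <= s -> 1 <= 1 + s ^ n) by (intros; now apply one_plus_pow_pos).
  assert (Hln : RInt (fun s => s ^ (n - 1) / (1 + s ^ n)) 0 1 = ln 2 / INR n).
  { apply (is_RInt_unique (V := R_CompleteNormedModule)).
    replace (ln 2 / INR n) with (minus (ln (1 + 1 ^ n) / INR n) (ln (1 + 0 ^ n) / INR n)).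
    - apply (is_RInt_derive (fun s => ln (1 + s ^ n) / INR n) (fun s => s ^ (n - 1) / (1 + s ^ n)));
        intros s Hs;
        rewrite Rmin_left, Rmax_right in Hs by lra; specialize (HP s ltac:(lra)).
      + auto_derive; [lra|]. replace (pred n) with (n - 1)%nat by lia. field. lra.
      + apply (ex_derive_continuous (fun s => s ^ (n - 1) / (1 + s ^ n))). auto_derive. lra.
    - unfold minus, plus, opp; simpl. rewrite pow1, pow_i by lia.
      replace (1 + 0) with 1 by ring. replace (1 + 1) with 2 by ring. rewrite ln_1. field. lra. }
  pose proof (digamma_duplication (1 / INR n) ltac:(apply Rdiv_lt_0_compat; lra)) as HD.
  replace (2 * (1 / INR n)) with (2 / INR n) in HD by (field; lra).
  pose proof (digamma_diff_RInt 1 n (2 * n) ltac:(lia)) as H1.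
  rewrite mult_INR in H1. change (INR 2) with 2 in H1. change (INR 1) with 1 in H1.
  replace ((1 + 1 + INR n) / (2 * INR n)) with (1 / INR n + / 2) in H1 by (field; lra).
  replace ((1 + 1) / (2 * INR n)) with (1 / INR n) in H1 by (field; lra).
  rewrite (RInt_ext _ (fun s => s / (1 + s ^ n))) in H1.
  2: { rewrite Rmin_left, Rmax_right by lra. intros s Hs. rewrite geom_double.
       pose proof (geom_ge_1 n s Hn ltac:(lra)). specialize (HP s ltac:(lra)). rewrite pow_1. as_R.
       field. lra. }
  rewrite (RInt_ext _ (fun s => 1 * (s / (1 + s ^ n)) + 1 * (s ^ (n - 1) / (1 + s ^ n)))).
  2: { rewrite Rmin_left, Rmax_right by lra. intros s Hs. specialize (HP s ltac:(lra)). as_R. field.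
    lra. }
  rewrite RInt_lin, Hln.
  2, 3: ex_int01; specialize (HP t ltac:(lra)); lra.
  assert (E : digamma (1 / INR n + / 2) = digamma (1 / INR n) + 2 * INR n * RInt (fun s : R => s / (1
    + s ^ n)) 0 1) by lra.
  rewrite HD, E. field. lra.
Qed.

(** If [c = cos t] and [n t] is a multiple of [2 PI], this is the sum of [s^(l - 1) cos (l t)] over
    [1 <= l <= n - 1], divided by [1 + s^n]. The closed form makes sense for every angle and depends
    on [cos t] alone. *)
Definition cos_kernel (n : nat) (c s : R) : R :=
  (c - s - s ^ (n - 1) + c * s ^ n) / (Qpoly c s * (1 + s ^ n)).

(** For [c = cos t] and [0 <= s < 1], [sin t] times this is the sum of
    [beta_kernel n j s * sin ((j + 2) t)] over [j >= 0]. The factor [sin t] is taken out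
    algebraically, through [sin (2 t) = 2 sin t cos t], so nothing is singular at [t = PI]. *)
Definition tail_kernel (n : nat) (c s : R) : R :=
  (1 - s ^ 2) * (2 * c - s) / (Qpoly c s * (1 + s ^ n)).

Ltac kernel_pos c n s Hc :=
  pose proof (Qpoly_lower c s Hc ltac:(lra)); pose proof (one_plus_pow_pos n s ltac:(lra)).

Lemma ex_RInt_tail_kernel (n : nat) (c : R) : -1 <= c < 1 -> ex_RInt (tail_kernel n c) 0 1.
Proof.
  intros Hc. unfold tail_kernel. apply ex_RInt_of_derive. intros t Ht.
  rewrite Rmin_left, Rmax_right in Ht by lra. kernel_pos c n t Hc. unfold Qpoly in *.
  auto_derive. apply Rgt_not_eq, Rmult_lt_0_compat; lra.
Qed.

Lemma ex_RInt_cos_kernel (n : nat) (c : R) : -1 <= c < 1 -> ex_RInt (cos_kernel n c) 0 1.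
Proof.
  intros Hc. unfold cos_kernel. apply ex_RInt_of_derive. intros t Ht.
  rewrite Rmin_left, Rmax_right in Ht by lra. kernel_pos c n t Hc. unfold Qpoly in *.
  auto_derive. apply Rgt_not_eq, Rmult_lt_0_compat; lra.
Qed.

Lemma RInt_cos_kernel (n : nat) (t : R) : (1 <= n)%nat -> 0 < t < 2 * PI ->
  INR n * RInt (cos_kernel n (cos t)) 0 1
  = INR n * ln (2 * sin (t / 2)) - (digamma (2 / INR n) - digamma (1 / INR n))
    + INR n * RInt (tail_kernel n (cos t)) 0 1.
Proof.
  intros Hn Ht. pose proof (cos_lt_1 t Ht) as Hc.
  rewrite digamma_two_one_RInt, <- RInt_log_kernel by assumption.
  set (c := cos t) in *.
  rewrite (RInt_ext (cos_kernel n c)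
    (fun s => 1 * (1 * ((s - c) / Qpoly c s) + 1 * tail_kernel n c s) + (-1) * ((s
      + s ^ (n - 1)) / (1 + s ^ n)))).
  - assert (X1 : ex_RInt (fun s => (s - c) / Qpoly c s) 0 1).
    { ex_int01. kernel_pos c n t0 Hc. unfold Qpoly in *. split; [|split; [lra|trivial]].
      auto_derive; trivial. }
    rewrite RInt_lin.
    + rewrite RInt_lin; [ring | exact X1 | now apply ex_RInt_tail_kernel].
    + apply (ex_RInt_plus (V := R_NormedModule)); apply (ex_RInt_scal (V := R_NormedModule));
        [exact X1 | now apply ex_RInt_tail_kernel].
    + ex_int01. kernel_pos c n t0 Hc. lra.
  - rewrite Rmin_left, Rmax_right by lra. intros s Hs. kernel_pos c n s Hc.
    unfold cos_kernel, tail_kernel.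
    apply Rmult_eq_reg_r with (Qpoly c s * (1 + s ^ n)).
    2: apply Rgt_not_eq, Rmult_lt_0_compat; lra.
    match goal with |- ?l = ?r =>
      transitivity (c - s - s ^ (n - 1) + c * s ^ n); [field; lra|];
      transitivity ((s - c) * (1 + s ^ n) + (1 - s ^ 2) * (2 * c - s) - (s + s ^ (n - 1)) * Qpoly c s);
        [|field; lra] end.
    assert (E : s ^ n = s * s ^ (n - 1)) by (replace n with (S (n - 1)) at 1 by lia; reflexivity).
    rewrite E. unfold Qpoly. ring.
Qed.

Lemma is_series_of_sum_lt (a : nat -> R) (l : R) : is_lim_seq (sum_lt a) l -> is_series a l.
Proof.
  intros H. apply (is_lim_seq_incr_1 (sum_lt a)) in H.
  apply (is_lim_seq_ext _ (sum_n a)) in H; [exact H|].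
  intros N. induction N as [|N IH].
  - rewrite sum_O. simpl. ring.
  - rewrite sum_Sn, <- IH. reflexivity.
Qed.

Lemma sin_step (x t : R) : sin (x + t) + sin (x - t) = 2 * cos t * sin x.
Proof. rewrite sin_plus, sin_minus. ring. Qed.

Lemma cos_step (x t : R) : cos (x + t) + cos (x - t) = 2 * cos t * cos x.
Proof. rewrite cos_plus, cos_minus. ring. Qed.

(** Under the integral the sine sum obeys a three-term recurrence, and [r N] is the closed form of
    its remainder from index [N] on. Each term is therefore [r N - r (S N)] exactly. *)
Lemma is_series_psi_coef (n : nat) (t : R) : (1 <= n)%nat -> 0 < t < 2 * PI ->
  is_series (fun k => psi_coef n (k + 2) * sin (INR (k + 2) * t))
    (- INR n * (sin t * RInt (tail_kernel n (cos t)) 0 1)).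
Proof.
  intros Hn Ht. pose proof (cos_lt_1 t Ht) as Hc. set (c := cos t) in *.
  set (r := fun N s => s ^ N * (sin (INR (N + 2) * t) - s * sin (INR (N
    + 1) * t)) * (1 - s ^ 2) / (Qpoly c s * (1 + s ^ n))).
  assert (Xr : forall N, ex_RInt (r N) 0 1).
  { intros N. unfold r. apply ex_RInt_of_derive. intros u Hu.
    rewrite Rmin_left, Rmax_right in Hu by lra. kernel_pos c n u Hc. unfold Qpoly in *.
    auto_derive. apply Rgt_not_eq, Rmult_lt_0_compat; lra. }
  assert (R0 : sin t * RInt (tail_kernel n c) 0 1 = RInt (r 0%nat) 0 1).
  { rewrite <- RInt_scal_l by now apply ex_RInt_tail_kernel.
    apply RInt_ext. rewrite Rmin_left, Rmax_right by lra. intros s Hs. kernel_pos c n s Hc.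
    unfold r, tail_kernel. simpl (INR _). replace ((1 + 1) * t) with (2 * t) by ring.
    rewrite pow_O, sin_2a, !Rmult_1_l. fold c. as_R. field. lra. }
  assert (RS : forall N, sum_lt (fun k => psi_coef n (k + 2) * sin (INR (k + 2) * t)) N
                 = - INR n * (RInt (r 0%nat) 0 1 - RInt (r N) 0 1)).
  { induction N as [|N IH]; cbn [sum_lt]; [ring|]. rewrite IH, psi_coef_RInt by assumption.
    enough (E : sin (INR (N + 2) * t) * RInt (beta_kernel n N) 0 1 = RInt (r N) 0 1 - RInt (r (S N)) 0 1)
      by (transitivity (- INR n * (RInt (r 0%nat) 0 1 - RInt (r N) 0 1 + sin (INR (N
        + 2) * t) * RInt (beta_kernel n N) 0 1)); [ring | rewrite E; ring]).
    rewrite <- RInt_scal_l by apply ex_RInt_beta_kernel.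
    transitivity (RInt (fun s => 1 * r N s + (-1) * r (S N) s) 0 1); [|rewrite RInt_lin by apply Xr;
      ring].
    apply RInt_ext. rewrite Rmin_left, Rmax_right by lra. intros s Hs. kernel_pos c n s Hc.
    unfold r, beta_kernel.
    pose proof (sin_step (INR (N + 2) * t) t) as E.
    replace (INR (N + 2) * t + t) with (INR (S N + 2) * t) in E by (rewrite !plus_INR, S_INR; ring).
    replace (INR (N + 2) * t - t) with (INR (N + 1) * t) in E by (rewrite !plus_INR; simpl; ring).
    replace (S N + 1)%nat with (N + 2)%nat by lia. fold c in E.
    replace (sin (INR (S N + 2) * t))
      with (2 * c * sin (INR (N + 2) * t) - sin (INR (N + 1) * t)) by lra.
    set (x := sin (INR (N + 2) * t)) in *. set (y := sin (INR (N + 1) * t)) in *.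
    apply Rmult_eq_reg_r with (Qpoly c s * (1 + s ^ n)).
    2: apply Rgt_not_eq, Rmult_lt_0_compat; lra.
    transitivity (x * s ^ N * (1 - s ^ 2) * Qpoly c s); [field; lra|].
    transitivity (s ^ N * (x - s * y) * (1 - s ^ 2) - s ^ S N * (2 * c * x - y - s * x) * (1 - s ^ 2));
      [|field; lra].
    unfold Qpoly. simpl. ring. }
  apply is_series_of_sum_lt.
  apply (is_lim_seq_ext (fun N => - INR n * (RInt (r 0%nat) 0 1 - RInt (r N) 0 1))); [intros;
    now rewrite RS|].
  rewrite R0.
  replace (- INR n * RInt (r 0%nat) 0 1) with (- INR n * (RInt (r 0%nat) 0 1 - 0)) by ring.
  apply (is_lim_seq_scal_l _ (- INR n) (Finite _)). apply is_lim_seq_minus'; [apply is_lim_seq_const|].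
  apply is_lim_seq_abs_0.
  (* The constant is [2] for the bracket of sines times [2 / (1 - c)] from [Qpoly_lower]; [s^N]
     integrates to [1 / (N + 1)]. *)
  apply (is_lim_seq_le_le (fun _ => 0) _ (fun N => (4 / (1 - c)) * / INR (S N))).
  - intros N. split; [apply Rabs_pos|].
    eapply Rle_trans; [apply abs_RInt_le; [lra | apply Xr]|].
    rewrite S_INR, <- RInt_01_pow, <- RInt_scal_l by ex_int01.
    apply RInt_le; [lra | apply (ex_RInt_norm (r N) 0 1), Xr | ex_int01 |].
    intros s Hs. kernel_pos c n s Hc. unfold r.
    rewrite Rdiv_def, !Rabs_mult, Rabs_inv.
    rewrite (Rabs_pos_eq (s ^ N)) by (apply pow_le; lra).
    rewrite (Rabs_pos_eq (Qpoly c s * _)) by (apply Rmult_le_pos; lra).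
    pose proof (pow_le_1 s 2 ltac:(lra)).
    rewrite (Rabs_pos_eq (1 - s ^ 2)) by lra.
    assert (B : Rabs (sin (INR (N + 2) * t) - s * sin (INR (N + 1) * t)) <= 2).
    { pose proof (SIN_bound (INR (N + 2) * t)). pose proof (SIN_bound (INR (N + 1) * t)).
      apply Rabs_le. nra. }
    assert (B2 : / (Qpoly c s * (1 + s ^ n)) <= 2 / (1 - c)).
    { replace (2 / (1 - c)) with (/ ((1 - c) / 2)) by (field; lra). apply Rinv_le_contravar; [lra|].
      nra. }
    pose proof (pow_le s N ltac:(lra)) as B3.
    assert (B4 : 0 < / (Qpoly c s * (1 + s ^ n))) by (apply Rinv_0_lt_compat, Rmult_lt_0_compat; lra).
    set (A := Rabs (sin (INR (N + 2) * t) - s * sin (INR (N + 1) * t))) in *.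
    assert (0 <= A) by apply Rabs_pos.
    replace (4 / (1 - c) * s ^ N) with (s ^ N * 2 * 1 * (2 / (1 - c))) by (field; lra).
    repeat apply Rmult_le_compat; try lra; repeat apply Rmult_le_pos; lra.
  - apply is_lim_seq_const.
  - replace (Finite 0) with (Rbar_mult (4 / (1 - c)) 0) by (simpl; f_equal; ring).
    apply is_lim_seq_scal_l. apply (is_lim_seq_incr_1 (fun N => / INR N)).
    apply (is_lim_seq_inv _ p_infty); [apply is_lim_seq_INR | discriminate].
Qed.

(** * The cosecant sum *)

Lemma RInt_sum_lt (f : nat -> R -> R) (a b : R) (N : nat) :
  (forall k, (k < N)%nat -> ex_RInt (f k) a b) ->
  ex_RInt (fun s => sum_lt (fun k => f k s) N) a b /\
  RInt (fun s => sum_lt (fun k => f k s) N) a b = sum_lt (fun k => RInt (f k) a b) N.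
Proof.
  induction N as [|N IH]; intros H; cbn [sum_lt].
  - split; [apply (ex_RInt_const (V := R_NormedModule))|].
    rewrite (RInt_const (V := R_CompleteNormedModule)). unfold scal; simpl; unfold mult; simpl. ring.
  - destruct IH as [E1 E2]; [intros; apply H; lia|].
    pose proof (H N ltac:(lia)) as HN. split.
    + now apply (ex_RInt_plus (V := R_NormedModule)).
    + rewrite <- E2. exact (RInt_plus (V := R_CompleteNormedModule) _ _ _ _ E1 HN).
Qed.

Lemma sum_lt_swap (f : nat -> nat -> R) (N M : nat) :
  sum_lt (fun j => sum_lt (fun k => f j k) M) N = sum_lt (fun k => sum_lt (fun j => f j k) N) M.
Proof.
  induction M as [|M IH]; cbn [sum_lt].
  - induction N as [|N IHN]; cbn [sum_lt]; [reflexivity|]. rewrite IHN. ring.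
  - rewrite <- IH. transitivity (1 * sum_lt (fun j => sum_lt (fun k => f j k) M) N
      + 1 * sum_lt (fun j => f j M) N); [|ring].
    rewrite <- sum_lt_lin. apply sum_lt_ext. intros; ring.
Qed.

Lemma sum_lt_scal_l (f : nat -> R) (a : R) (N : nat) :
  sum_lt (fun k => a * f k) N = a * sum_lt f N.
Proof. induction N as [|N IH]; cbn [sum_lt]; [ring|]. rewrite IH. ring. Qed.

Lemma sum_lt_delta (f : nat -> R) (i N : nat) : (i < N)%nat ->
  sum_lt (fun k => (if Nat.eqb k i then 1 else 0) * f k) N = f i.
Proof.
  intros Hi.
  assert (Z : forall M, (M <= i)%nat -> sum_lt (fun k => (if Nat.eqb k i then 1 else 0) * f k) M = 0).
  { induction M as [|M IH]; intros HM; cbn [sum_lt]; [reflexivity|]. rewrite IH by lia.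
    destruct (Nat.eqb_spec M i); [lia|ring]. }
  induction Hi as [|N Hi IH]; cbn [sum_lt].
  - rewrite Z, Nat.eqb_refl by lia. ring.
  - rewrite IH. destruct (Nat.eqb_spec N i); [lia|ring].
Qed.

Lemma sum_lt_head (f : nat -> R) (N : nat) : sum_lt f (S N) = f 0%nat + sum_lt (fun k => f (S k)) N.
Proof. induction N as [|N IH]; [simpl; ring|]. cbn [sum_lt] in *. rewrite IH. ring. Qed.

Lemma sum_lt_rev (f : nat -> R) (N : nat) :
  sum_lt (fun k => f (N - 1 - k)%nat) N = sum_lt f N.
Proof.
  induction N as [|N IH]; [reflexivity|]. rewrite sum_lt_head.
  replace (S N - 1 - 0)%nat with N by lia. cbn [sum_lt].
  rewrite <- IH, Rplus_comm. f_equal. apply sum_lt_ext. intros k Hk. f_equal. lia.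
Qed.

(** [Qpoly] encodes the recurrence [sin_step], so multiplying by it cancels all but the terms at the
    two ends. *)
Lemma sum_pow_sin (s t : R) (N : nat) :
  Qpoly (cos t) s * sum_lt (fun j => s ^ j * sin (INR (S j) * t)) N
  = sin t - s ^ N * (sin (INR (S N) * t) - s * sin (INR N * t)).
Proof.
  induction N as [|N IH]; cbn [sum_lt].
  - simpl. rewrite !Rmult_1_l, Rmult_0_l, sin_0. ring.
  - rewrite Rmult_plus_distr_l, IH.
    pose proof (sin_step (INR (S N) * t) t) as E.
    replace (INR (S N) * t + t) with (INR (S (S N)) * t) in E by (rewrite !S_INR; ring).
    replace (INR (S N) * t - t) with (INR N * t) in E by (rewrite !S_INR; ring).
    replace (sin (INR (S (S N)) * t)) with (2 * cos t * sin (INR (S N) * t) - sin (INR N * t)) by lra.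
    unfold Qpoly. simpl pow. ring.
Qed.

Lemma sum_pow_cos (s t : R) (N : nat) :
  Qpoly (cos t) s * sum_lt (fun j => s ^ j * cos (INR (S j) * t)) N
  = cos t - s - s ^ N * (cos (INR (S N) * t) - s * cos (INR N * t)).
Proof.
  induction N as [|N IH]; cbn [sum_lt].
  - simpl. rewrite !Rmult_1_l, Rmult_0_l, cos_0. ring.
  - rewrite Rmult_plus_distr_l, IH.
    pose proof (cos_step (INR (S N) * t) t) as E.
    replace (INR (S N) * t + t) with (INR (S (S N)) * t) in E by (rewrite !S_INR; ring).
    replace (INR (S N) * t - t) with (INR N * t) in E by (rewrite !S_INR; ring).
    replace (cos (INR (S (S N)) * t)) with (2 * cos t * cos (INR (S N) * t) - cos (INR N * t)) by lra.
    unfold Qpoly. simpl pow. ring.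
Qed.

Lemma sum_cos_odd (x : R) (N : nat) :
  2 * sin x * sum_lt (fun k => cos ((2 * INR k + 1) * x)) N = sin (2 * INR N * x).
Proof.
  induction N as [|N IH]; cbn [sum_lt].
  - simpl. replace (2 * 0 * x) with 0 by ring. rewrite sin_0. ring.
  - rewrite Rmult_plus_distr_l, IH.
    replace (2 * INR (S N) * x) with ((2 * INR N + 1) * x + x) by (rewrite S_INR; ring).
    replace (2 * INR N * x) with ((2 * INR N + 1) * x - x) by ring.
    rewrite sin_plus, sin_minus. ring.
Qed.

Lemma sum_cos_even (x : R) (N : nat) :
  2 * sin x * sum_lt (fun k => cos (2 * INR (S k) * x)) N = sin ((2 * INR N + 1) * x) - sin x.
Proof.
  induction N as [|N IH]; cbn [sum_lt].
  - simpl. replace ((2 * 0 + 1) * x) with x by ring. ring.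
  - rewrite Rmult_plus_distr_l, IH.
    replace ((2 * INR (S N) + 1) * x) with (2 * INR (S N) * x + x) by ring.
    replace ((2 * INR N + 1) * x) with (2 * INR (S N) * x - x) by (rewrite S_INR; ring).
    rewrite sin_plus, sin_minus. ring.
Qed.

Lemma sin_2PI_nat (k : nat) : sin (2 * INR k * PI) = 0.
Proof. rewrite <- (Rplus_0_l (2 * INR k * PI)), sin_period. apply sin_0. Qed.

Lemma cos_2PI_nat (k : nat) : cos (2 * INR k * PI) = 1.
Proof. rewrite <- (Rplus_0_l (2 * INR k * PI)), cos_period. apply cos_0. Qed.

Lemma sin_frac_PI_pos (j n : nat) : (1 <= j)%nat -> (j < n)%nat -> 0 < sin (INR j * PI / INR n).
Proof.
  intros Hj Hjn. pose proof PI_RGT_0. apply le_INR in Hj. simpl in Hj. apply lt_INR in Hjn.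
  apply sin_gt_0.
  - apply Rdiv_lt_0_compat; [apply Rmult_lt_0_compat|]; lra.
  - apply Rmult_lt_reg_r with (INR n); [lra|]. unfold Rdiv.
    rewrite Rmult_assoc, Rinv_l, Rmult_1_r by lra. nra.
Qed.

(** The arguments of the poles of [1 / (1 + s^n)]. *)
Definition odd_angle (n k : nat) : R := (2 * INR k + 1) * PI / INR n.

Lemma odd_angle_bounds (n k : nat) : (k < n)%nat -> 0 < odd_angle n k < 2 * PI.
Proof.
  intros Hk. pose proof PI_RGT_0. pose proof (pos_INR k).
  assert (Hn : INR k + 1 <= INR n) by (rewrite <- S_INR; apply le_INR; lia).
  unfold odd_angle. split.
  - apply Rdiv_lt_0_compat; [apply Rmult_lt_0_compat|]; lra.
  - apply Rmult_lt_reg_r with (INR n); [lra|]. unfold Rdiv.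
    rewrite Rmult_assoc, Rinv_l, Rmult_1_r by lra. nra.
Qed.

Lemma sin_n_odd_angle (n k : nat) : (1 <= n)%nat -> sin (INR n * odd_angle n k) = 0.
Proof.
  intros Hn. apply le_INR in Hn. simpl in Hn.
  replace (INR n * odd_angle n k) with (2 * INR k * PI + PI) by (unfold odd_angle; field; lra).
  rewrite neg_sin, sin_2PI_nat. ring.
Qed.

Lemma cos_n_odd_angle (n k : nat) : (1 <= n)%nat -> cos (INR n * odd_angle n k) = -1.
Proof.
  intros Hn. apply le_INR in Hn. simpl in Hn.
  replace (INR n * odd_angle n k) with (2 * INR k * PI + PI) by (unfold odd_angle; field; lra).
  rewrite neg_cos, cos_2PI_nat. ring.
Qed.

Lemma sum_cos_odd_angle (n j : nat) : (1 <= j < 2 * n)%nat ->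
  sum_lt (fun k => cos (INR j * odd_angle n k)) n = if Nat.eqb j n then - INR n else 0.
Proof.
  intros Hj. assert (Hn : 1 <= INR n) by (change 1 with (INR 1); apply le_INR; lia).
  destruct (Nat.eqb_spec j n) as [->|Hne].
  - rewrite (sum_lt_ext _ (fun _ => -1)) by (intros; apply cos_n_odd_angle; lia).
    generalize n. intros m. induction m as [|m IH]; cbn [sum_lt]; [simpl; ring|]. rewrite IH, S_INR.
    ring.
  - pose proof (sum_cos_odd (INR j * PI / INR n) n) as E.
    replace (2 * INR n * (INR j * PI / INR n)) with (2 * INR j * PI) in E by (field; lra).
    rewrite sin_2PI_nat in E.
    rewrite (sum_lt_ext _ (fun k => cos ((2 * INR k + 1) * (INR j * PI / INR n)))).
    2: { intros k _. f_equal. unfold odd_angle. field. lra. }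
    enough (sin (INR j * PI / INR n) <> 0) by (apply Rmult_integral in E; destruct E; [nra|assumption]).
    destruct (Nat.le_gt_cases n j).
    + replace (INR j * PI / INR n) with (INR (j - n) * PI / INR n + PI) by (rewrite minus_INR by lia;
        field; lra).
      rewrite neg_sin. pose proof (sin_frac_PI_pos (j - n) n ltac:(lia) ltac:(lia)). lra.
    + pose proof (sin_frac_PI_pos j n ltac:(lia) ltac:(lia)). lra.
Qed.

(** Orthogonality by the product formula. The second indicator comes from [l + j = n], where every
    cosine is [-1] and the minus sign of the product formula makes the contribution positive. *)
Lemma sum_sin_sin_odd_angle (n l j : nat) : (1 <= l < n)%nat -> (1 <= j <= n)%nat ->
  sum_lt (fun k => sin (INR l * odd_angle n k) * sin (INR j * odd_angle n k)) n
  = INR n / 2 * ((if Nat.eqb j l then 1 else 0) + (if Nat.eqb j (n - l) then 1 else 0)).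
Proof.
  intros Hl Hj.
  set (d := (Nat.max l j - Nat.min l j)%nat).
  rewrite (sum_lt_ext _ (fun k => / 2 * cos (INR d * odd_angle n k) + (- / 2) * cos (INR (l
    + j) * odd_angle n k))).
  2: { intros k _. set (o := odd_angle n k).
       assert (E : cos (INR d * o) = cos (INR l * o - INR j * o)).
       { unfold d. destruct (Nat.le_gt_cases l j).
         - rewrite Nat.max_r, Nat.min_l, minus_INR by lia. rewrite <- cos_neg. f_equal. ring.
         - rewrite Nat.max_l, Nat.min_r, minus_INR by lia. f_equal. ring. }
       rewrite E, plus_INR, Rmult_plus_distr_r, cos_minus, cos_plus. field. }
  rewrite sum_lt_lin, (sum_cos_odd_angle n (l + j)) by lia.
  assert (E : sum_lt (fun k => cos (INR d * odd_angle n k)) n = if Nat.eqb j l then INR n else 0).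
  { destruct (Nat.eqb_spec j l) as [->|Hne].
    - replace d with 0%nat by (unfold d; lia).
      rewrite (sum_lt_ext _ (fun _ => 1)) by (intros; simpl; rewrite Rmult_0_l; apply cos_0).
      generalize n. intros m. induction m as [|m IH]; cbn [sum_lt]; [simpl; ring|]. rewrite IH, S_INR.
      ring.
    - rewrite sum_cos_odd_angle by (unfold d; lia).
      destruct (Nat.eqb_spec d n); [unfold d in *; lia|reflexivity]. }
  rewrite E. destruct (Nat.eqb_spec j l), (Nat.eqb_spec (l + j) n), (Nat.eqb_spec j (n - l)); try lia;
    field.
Qed.

(* Unlike [atan ((s - cos t) / sin t)], this antiderivative is smooth on [[0, 1]] even for [t = PI]. *)
Lemma RInt_poisson_kernel (t : R) : 0 < t < 2 * PI ->
  ex_RInt (fun s => sin t / Qpoly (cos t) s) 0 1 /\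
  RInt (fun s => sin t / Qpoly (cos t) s) 0 1 = (PI - t) / 2.
Proof.
  intros Ht. pose proof (cos_lt_1 t Ht) as Hc.
  assert (Hs : 0 < sin (t / 2)) by (apply sin_gt_0; lra).
  assert (HI : is_RInt (fun s => sin t / Qpoly (cos t) s) 0 1
    (minus (atan (1 * sin t / (1 - 1 * cos t))) (atan (0 * sin t / (1 - 0 * cos t))))).
  { apply (is_RInt_derive (fun s => atan (s * sin t / (1
      - s * cos t))) (fun s => sin t / Qpoly (cos t) s)); intros s Hs0;
      rewrite Rmin_left, Rmax_right in Hs0 by lra;
        pose proof (Qpoly_lower (cos t) s Hc ltac:(lra)) as HQ.
    - assert (H1 : 0 < 1 - s * cos t) by nra.
      assert (E : sin t * sin t = 1 - cos t * cos t) by (pose proof (sin2_cos2 t); unfold Rsqr in *;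
        lra).
      assert (EQ : (1 - s * cos t) ^ 2 + (s * sin t) ^ 2 = Qpoly (cos t) s).
      { unfold Qpoly. replace ((s * sin t) ^ 2) with (s ^ 2 * (sin t * sin t)) by ring. rewrite E.
        ring. }
      auto_derive; [lra|]. unfold Rsqr.
      rewrite <- EQ in *. field. repeat split; nra.
    - apply (ex_derive_continuous (fun s => sin t / Qpoly (cos t) s)). unfold Qpoly in *. auto_derive.
      lra. }
  assert (EV : minus (atan (1 * sin t / (1 - 1 * cos t))) (atan (0 * sin t / (1 - 0 * cos t))) = (PI
    - t) / 2).
  { replace (0 * sin t / (1 - 0 * cos t)) with 0 by field. rewrite atan_0.
    unfold minus, plus, opp; simpl.
    replace (1 * sin t / (1 - 1 * cos t)) with (tan ((PI - t) / 2)).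
    - rewrite atan_tan by lra. ring.
    - replace ((PI - t) / 2) with (PI / 2 - t / 2) by field. unfold tan.
      rewrite sin_shift, cos_shift.
      replace (sin t) with (sin (2 * (t / 2))) by (f_equal; field).
      replace (cos t) with (cos (2 * (t / 2))) by (f_equal; field).
      rewrite cos_2a_sin, sin_2a. field. split; nra. }
  split; [eexists; exact HI|].
  rewrite <- EV. now apply (is_RInt_unique (V := R_CompleteNormedModule)).
Qed.

(** The weight is twice the Poisson integral at [odd_angle n k]. Multiplied by [2 sin y], the sines
    become differences of cosines; as the weights are in arithmetic progression, summation by parts
    leaves a cosine sum over full periods, which vanishes, and the boundary value [2 PI]. *)
Lemma sum_sin_odd_angle_weighted (n l : nat) : (1 <= l < n)%nat ->
  sum_lt (fun k => sin (INR l * odd_angle n k) * (PI - odd_angle n k)) n = PI * csc (PI * INR l / INR n).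
Proof.
  intros Hl. assert (Hn : 1 <= INR n) by (change 1 with (INR 1); apply le_INR; lia).
  set (y := PI * INR l / INR n).
  assert (Hy : 0 < sin y).
  { unfold y. rewrite (Rmult_comm PI). apply sin_frac_PI_pos; lia. }
  assert (HS : forall N, 2 * sin y * sum_lt (fun k => sin (INR l * odd_angle n k) * (PI
    - odd_angle n k)) N
    = (PI - odd_angle n 0) - (PI - odd_angle n N) * cos (2 * INR N * y)
      - 2 * PI / INR n * sum_lt (fun k => cos (2 * INR (S k) * y)) N).
  { induction N as [|N IH]; cbn [sum_lt].
    - simpl (INR 0). replace (2 * 0 * y) with 0 by ring. rewrite cos_0. ring.
    - rewrite Rmult_plus_distr_l, IH.
      replace (odd_angle n (S N)) with (odd_angle n N + 2 * PI / INR n) by (unfold odd_angle;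
        rewrite S_INR; field; lra).
      assert (E : 2 * sin y * sin (INR l * odd_angle n N) = cos (2 * INR N * y)
        - cos (2 * INR (S N) * y)).
      { replace (INR l * odd_angle n N) with ((2 * INR N + 1) * y) by (unfold odd_angle, y; field; lra).
        replace (2 * INR N * y) with ((2 * INR N + 1) * y - y) by ring.
        replace (2 * INR (S N) * y) with ((2 * INR N + 1) * y + y) by (rewrite S_INR; ring).
        rewrite cos_minus, cos_plus. ring. }
      replace (2 * sin y * (sin (INR l * odd_angle n N) * (PI - odd_angle n N)))
        with ((PI - odd_angle n N) * (2 * sin y * sin (INR l * odd_angle n N))) by ring.
      rewrite E. ring. }
  specialize (HS n).
  pose proof (sum_cos_even y n) as HE.
  assert (Ey : 2 * INR n * y = 2 * INR l * PI) by (unfold y; field; lra).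
  replace ((2 * INR n + 1) * y) with (y + 2 * INR l * PI) in HE by (rewrite <- Ey; ring).
  rewrite sin_period in HE. rewrite Ey, cos_2PI_nat in HS.
  assert (HZ : sum_lt (fun k => cos (2 * INR (S k) * y)) n = 0) by nra.
  rewrite HZ in HS.
  replace (odd_angle n n) with (odd_angle n 0 + 2 * PI) in HS by (unfold odd_angle; simpl; field; lra).
  unfold csc. apply Rmult_eq_reg_l with (2 * sin y); [|lra]. rewrite HS. field. lra.
Qed.

(* Partial fractions of [s^j / (1 + s^n)] over the roots [exp (i * odd_angle n k)] of [-1]. *)
Lemma csc_RInt (n l : nat) : (1 <= l < n)%nat ->
  PI * csc (PI * INR l / INR n)
  = INR n * RInt (fun s => (s ^ (l - 1) + s ^ (n - l - 1)) / (1 + s ^ n)) 0 1.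
Proof.
  intros Hl. assert (Hn : 1 <= INR n) by (change 1 with (INR 1); apply le_INR; lia).
  rewrite <- sum_sin_odd_angle_weighted by assumption.
  set (o := odd_angle n).
  rewrite (RInt_ext _ (fun s => sum_lt (fun k => 2 / INR n * sin (INR l * o k)
    * (sin (o k) / Qpoly (cos (o k)) s)) n)).
  - destruct (RInt_sum_lt (fun k s => 2 / INR n * sin (INR l * o k)
      * (sin (o k) / Qpoly (cos (o k)) s)) 0 1 n) as [_ ->].
    { intros k Hk. apply (ex_RInt_scal (V := R_NormedModule)).
      now apply RInt_poisson_kernel, odd_angle_bounds. }
    rewrite <- sum_lt_scal_l. apply sum_lt_ext. intros k Hk.
    destruct (RInt_poisson_kernel (o k) (odd_angle_bounds n k Hk)) as [X E].
    rewrite RInt_scal_l by exact X. rewrite E. field. lra.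
  - rewrite Rmin_left, Rmax_right by lra. intros s Hs.
    pose proof (one_plus_pow_pos n s ltac:(lra)) as HP.
    apply Rmult_eq_reg_l with (1 + s ^ n); [|lra].
    rewrite <- sum_lt_scal_l.
    (* Since [n * o k] is an odd multiple of [PI], [sum_pow_sin] makes [(1 + s^n) sin (o k) / Q] a
       polynomial in [s]. Summing over [k] first, orthogonality keeps only the powers [l - 1] and
       [n - l - 1]. *)
    transitivity (2 / INR n * sum_lt (fun k => sum_lt (fun j => s ^ j * (sin (INR l * o k)
      * sin (INR (S j) * o k))) n) n).
    + rewrite <- sum_lt_swap.
      rewrite (sum_lt_ext _ (fun j => INR n / 2 * ((if Nat.eqb j (l - 1) then 1 else 0) * s ^ j)
                                    + INR n / 2 * ((if Nat.eqb j (n - l - 1) then 1 else 0) * s ^ j))).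
      * rewrite sum_lt_lin, !sum_lt_delta by lia. field. lra.
      * intros j Hj. rewrite sum_lt_scal_l. unfold o. rewrite sum_sin_sin_odd_angle by lia.
        destruct (Nat.eqb_spec (S j) l), (Nat.eqb_spec (S j) (n - l)), (Nat.eqb_spec j (l
          - 1)), (Nat.eqb_spec j (n - l - 1));
          try lia; field.
    + rewrite <- sum_lt_scal_l. apply sum_lt_ext. intros k Hk.
      pose proof (sum_pow_sin s (o k) n) as E.
      pose proof (cos_lt_1 (o k) (odd_angle_bounds n k Hk)) as Hc.
      pose proof (Qpoly_lower (cos (o k)) s Hc ltac:(lra)) as HQ.
      assert (E1 : sin (INR n * o k) = 0) by (apply sin_n_odd_angle; lia).
      assert (E2 : sin (INR (S n) * o k) = - sin (o k)).
      { rewrite S_INR, Rmult_plus_distr_r, Rmult_1_l, sin_plus, E1. unfold o at 1.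
        rewrite cos_n_odd_angle by lia. ring. }
      rewrite E1, E2 in E.
      rewrite (sum_lt_ext _ (fun j => sin (INR l * o k) * (s ^ j * sin (INR (S j) * o k)))) by (intros;
        ring).
      rewrite sum_lt_scal_l.
      set (X := sum_lt _ n) in *.
      replace X with (sin (o k) * (1 + s ^ n) / Qpoly (cos (o k)) s).
      * field. lra.
      * apply Rmult_eq_reg_l with (Qpoly (cos (o k)) s); [|lra]. rewrite E. field. lra.
Qed.

Lemma sum_n_m_sum_lt (f : nat -> R) (N : nat) :
  sum_n_m f 1 N = sum_lt (fun k => f (S k)) N.
Proof.
  induction N as [|N IH]; [now rewrite sum_n_m_zero by lia|].
  rewrite sum_n_Sm by lia. rewrite IH. reflexivity.
Qed.

Lemma cos_csc_sum_RInt (n nu : nat) : (2 <= n)%nat -> (1 <= nu <= n - 1)%nat ->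
  sum_n_m (fun l : nat =>
      cos (2 * PI * INR nu * INR l / INR n) * csc (PI * INR l / INR n)) 1 (n - 1)
  = 2 * INR n / PI * RInt (cos_kernel n (cos (2 * PI * INR nu / INR n))) 0 1.
Proof.
  intros Hn Hnu. rewrite sum_n_m_sum_lt.
  assert (Hn1 : 1 <= INR n) by (change 1 with (INR 1); apply le_INR; lia).
  pose proof PI_RGT_0 as Hpi.
  set (t := 2 * PI * INR nu / INR n).
  assert (Ht : 0 < t < 2 * PI).
  { assert (1 <= INR nu) by (change 1 with (INR 1); apply le_INR; lia).
    assert (INR nu < INR n) by (apply lt_INR; lia).
    unfold t. split; [apply Rdiv_lt_0_compat; nra|].
    apply Rmult_lt_reg_r with (INR n); [lra|]. unfold Rdiv.
    rewrite Rmult_assoc, Rinv_l, Rmult_1_r by lra. nra. }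
  assert (Hnt : INR n * t = 2 * INR nu * PI) by (unfold t; field; lra).
  assert (Hrefl : forall x, cos (INR n * t - x) = cos x).
  { intros x. rewrite Hnt, cos_minus, cos_2PI_nat, sin_2PI_nat. ring. }
  pose proof (cos_lt_1 t Ht) as Hc.
  rewrite (sum_lt_ext _ (fun i => INR n / PI * RInt (fun s => cos (INR (S i) * t) * ((s ^ i
    + s ^ (n - 1 - 1 - i)) / (1 + s ^ n))) 0 1)).
  2: { intros i Hi. pose proof (csc_RInt n (S i) ltac:(lia)) as E.
       replace (S i - 1)%nat with i in E by lia.
       replace (n - S i - 1)%nat with (n - 1 - 1 - i)%nat in E by lia.
       rewrite RInt_scal_l.
       - transitivity (cos (INR (S i) * t) / PI * (PI * csc (PI * INR (S i) / INR n))).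
         + replace (2 * PI * INR nu * INR (S i) / INR n) with (INR (S i) * t) by (unfold t; field;
             lra). field. lra.
         + rewrite E. field. lra.
       - ex_int01. pose proof (one_plus_pow_pos n t0 ltac:(lra)). lra. }
  rewrite sum_lt_scal_l.
  destruct (RInt_sum_lt (fun i s => cos (INR (S i) * t) * ((s ^ i + s ^ (n - 1 - 1 - i)) / (1
    + s ^ n))) 0 1 (n - 1)) as [_ <-].
  { intros i Hi. ex_int01. pose proof (one_plus_pow_pos n t0 ltac:(lra)). lra. }
  replace (2 * INR n / PI) with (INR n / PI * 2) by (field; lra). rewrite Rmult_assoc. f_equal.
  rewrite <- RInt_scal_l by now apply ex_RInt_cos_kernel.
  apply RInt_ext. rewrite Rmin_left, Rmax_right by lra. intros s Hs. kernel_pos (cos t) n s Hc.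
  set (X := sum_lt (fun j => s ^ j * cos (INR (S j) * t)) (n - 1)).
  (* Replacing [l] by [n - l] preserves [cos (l t)], so the two powers in [csc_RInt] contribute
     equally; this is the factor [2]. *)
  assert (EX : X = sum_lt (fun i => cos (INR (S i) * t) * s ^ (n - 1 - 1 - i)) (n - 1)).
  { rewrite <- (sum_lt_rev (fun i => cos (INR (S i) * t) * s ^ (n - 1 - 1 - i))). apply sum_lt_ext.
    intros i Hi.
    replace (n - 1 - 1 - (n - 1 - 1 - i))%nat with i by lia.
    replace (S (n - 1 - 1 - i)) with (n - S i)%nat by lia. rewrite minus_INR by lia.
    rewrite Rmult_minus_distr_r, Hrefl. ring. }
  rewrite (sum_lt_ext _ (fun i => / (1 + s ^ n) * (s ^ i * cos (INR (S i) * t)) + / (1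
    + s ^ n) * (cos (INR (S i) * t) * s ^ (n - 1 - 1 - i))))
    by (intros; field; lra).
  rewrite sum_lt_lin, <- EX. fold X.
  pose proof (sum_pow_cos s t (n - 1)) as E. fold X in E.
  replace (S (n - 1)) with n in E by lia.
  assert (E1 : cos (INR n * t) = 1) by (rewrite Hnt; apply cos_2PI_nat).
  assert (E2 : cos (INR (n - 1) * t) = cos t).
  { rewrite minus_INR by lia. simpl (INR 1). rewrite Rmult_minus_distr_r, Rmult_1_l. apply Hrefl. }
  rewrite E1, E2 in E.
  assert (Es : s ^ n = s * s ^ (n - 1)) by (replace n with (S (n - 1)) at 1 by lia; reflexivity).
  unfold cos_kernel.
  replace (cos t - s - s ^ (n - 1) + cos t * s ^ n) with (Qpoly (cos t) s * X) by (rewrite E, Es; ring).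
  as_R. field. lra.
Qed.

(* The difference of the two integrands is
   [(c - c') (1 - s^2) (1 - s^n) / (Qpoly c s * Qpoly c' s * (1 + s^n))]. *)
Lemma cos_kernel_lipschitz (n : nat) (c c' : R) : (1 <= n)%nat -> -1 <= c <= 0 -> -1 <= c' <= 0 ->
  Rabs (RInt (cos_kernel n c) 0 1 - RInt (cos_kernel n c') 0 1) <= Rabs (c - c').
Proof.
  intros Hn Hc Hc'.
  assert (X : ex_RInt (cos_kernel n c) 0 1) by (apply ex_RInt_cos_kernel; lra).
  assert (X' : ex_RInt (cos_kernel n c') 0 1) by (apply ex_RInt_cos_kernel; lra).
  replace (RInt (cos_kernel n c) 0 1 - RInt (cos_kernel n c') 0 1)
    with (1 * RInt (cos_kernel n c) 0 1 + (-1) * RInt (cos_kernel n c') 0 1) by ring.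
  rewrite <- RInt_lin by assumption.
  replace (Rabs (c - c')) with ((1 - 0) * Rabs (c - c')) by ring.
  apply abs_RInt_le_const; [lra | |].
  { apply (ex_RInt_plus (V := R_NormedModule)); now apply (ex_RInt_scal (V := R_NormedModule)). }
  intros s Hs.
  (* The restriction to nonpositive cosines, that is to angles around [PI], makes all denominators
     at least [1] and gives the Lipschitz constant [1]. *)
  assert (HQ : forall d, -1 <= d <= 0 -> 1 <= Qpoly d s) by (intros d Hd; unfold Qpoly; nra).
  pose proof (HQ c Hc) as Q1. pose proof (HQ c' Hc') as Q2.
  pose proof (one_plus_pow_pos n s ltac:(lra)) as HP.
  pose proof (pow_le_1 s 2 ltac:(lra)) as S2. pose proof (pow_le_1 s n ltac:(lra)) as Sn.
  set (W := (1 - s ^ 2) * (1 - s ^ n) / (Qpoly c s * Qpoly c' s * (1 + s ^ n))).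
  assert (E : 1 * cos_kernel n c s + -1 * cos_kernel n c' s = (c - c') * W).
  { unfold cos_kernel, W.
    assert (Es : s ^ n = s * s ^ (n - 1)) by (replace n with (S (n - 1)) at 1 by lia; reflexivity).
    transitivity (((c - s - s ^ (n - 1) + c * s ^ n) * Qpoly c' s - (c' - s - s ^ (n - 1)
      + c' * s ^ n) * Qpoly c s)
      / (Qpoly c s * Qpoly c' s * (1 + s ^ n))); [field; lra|].
    unfold Rdiv. rewrite <- (Rmult_assoc (c - c')). f_equal. unfold Qpoly. rewrite Es. ring. }
  assert (HW : 0 <= W <= 1).
  { assert (D0 : 1 <= Qpoly c s * Qpoly c' s).
    { rewrite <- (Rmult_1_r 1) at 1. apply Rmult_le_compat; lra. }
    assert (D : 1 <= Qpoly c s * Qpoly c' s * (1 + s ^ n)).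
    { rewrite <- (Rmult_1_r 1) at 1. apply Rmult_le_compat; lra. }
    assert (N : 0 <= (1 - s ^ 2) * (1 - s ^ n) <= 1) by nra.
    unfold W. split.
    - apply Rmult_le_pos; [lra|]. left. apply Rinv_0_lt_compat. lra.
    - apply Rmult_le_reg_r with (Qpoly c s * Qpoly c' s * (1 + s ^ n)); [lra|].
      unfold Rdiv. rewrite Rmult_assoc, Rinv_l by lra. lra. }
  rewrite E, Rabs_mult, (Rabs_pos_eq W) by lra.
  rewrite <- (Rmult_1_r (Rabs (c - c'))) at 2. apply Rmult_le_compat_l; [apply Rabs_pos | lra].
Qed.

(** * The series formula for a real parameter and its limit at the singularity *)

Lemma digamma_series_formula (n : nat) (v : R) : (1 <= n)%nat ->
  0 < 2 * PI * v / INR n < 2 * PI -> sin (2 * PI * v / INR n) <> 0 ->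
  2 * INR n / PI * ln (2 * sin (PI * v / INR n))
    - 2 / PI * (digamma (2 / INR n) - digamma (1 / INR n))
    - 2 / PI * csc (2 * PI * v / INR n)
      * Series (fun k : nat =>
          psi_coef n (k + 2) * sin (2 * PI * v * INR (k + 2) / INR n))
  = 2 * INR n / PI * RInt (cos_kernel n (cos (2 * PI * v / INR n))) 0 1.
Proof.
  intros Hn Ht Hs.
  assert (Hn1 : 1 <= INR n) by (change 1 with (INR 1); apply le_INR; lia).
  pose proof PI_RGT_0 as Hpi.
  set (t := 2 * PI * v / INR n) in *.
  rewrite (Series_ext _ (fun k => psi_coef n (k + 2) * sin (INR (k + 2) * t))).
  2: { intros k. do 2 f_equal. unfold t. field. lra. }
  rewrite (is_series_unique _ _ (is_series_psi_coef n t Hn Ht)).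
  replace (PI * v / INR n) with (t / 2) by (unfold t; field; lra).
  pose proof (RInt_cos_kernel n t Hn Ht) as E.
  replace (2 * INR n / PI * RInt (cos_kernel n (cos t)) 0 1)
    with (2 / PI * (INR n * RInt (cos_kernel n (cos t)) 0 1)) by (field; lra).
  (* The cosecant cancels the factor [sin t] in the sum of the series; this is where [sin t <> 0] is
     used. *)
  rewrite E. unfold csc. field. lra.
Qed.

Lemma is_lim_cos_kernel (n : nat) (v0 : R) : (1 <= n)%nat -> 2 * v0 = INR n ->
  is_lim (fun v => 2 * INR n / PI * RInt (cos_kernel n (cos (2 * PI * v / INR n))) 0 1) v0
    (2 * INR n / PI * RInt (cos_kernel n (cos (2 * PI * v0 / INR n))) 0 1).
Proof.
  intros Hn Hv.
  assert (Hn1 : 1 <= INR n) by (change 1 with (INR 1); apply le_INR; lia).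
  pose proof PI_RGT_0 as Hpi.
  apply (is_lim_scal_l _ (2 * INR n / PI) v0 (Finite _)).
  set (g := fun v => RInt (cos_kernel n (cos (2 * PI * v / INR n))) 0 1).
  assert (E0 : cos (2 * PI * v0 / INR n) = -1).
  { replace (2 * PI * v0 / INR n) with PI by (rewrite <- Hv; field; lra). apply cos_PI. }
  set (m := fun v => Rabs (cos (2 * PI * v / INR n) - -1)).
  assert (Hm : is_lim m v0 0).
  { replace (Finite 0) with (Finite (m v0)) by (unfold m; rewrite E0; f_equal; rewrite Rminus_diag;
      apply Rabs_R0).
    apply is_lim_continuity, continuity_pt_filterlim.
    apply (continuous_comp (fun v => cos (2 * PI * v / INR n) - -1) Rabs).
    - apply (ex_derive_continuous (fun v => cos (2 * PI * v / INR n) - -1)). auto_derive. trivial.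
    - apply continuous_Rabs. }
  apply (is_lim_le_le_loc (fun v => g v0 - m v) (fun v => g v0 + m v)).
  - assert (H4 : 0 < INR n / 4) by lra.
    exists (mkposreal _ H4). intros v Hv0 _.
    unfold ball in Hv0; simpl in Hv0; unfold AbsRing_ball, abs, minus, plus, opp in Hv0; simpl in Hv0.
    apply Rabs_def2 in Hv0.
    assert (Hc : cos (2 * PI * v / INR n) <= 0).
    { apply cos_le_0; apply Rmult_le_reg_r with (INR n); try lra;
        unfold Rdiv; rewrite !Rmult_assoc, Rinv_l, Rmult_1_r by lra; nra. }
    pose proof (COS_bound (2 * PI * v / INR n)).
    pose proof (cos_kernel_lipschitz n (cos (2 * PI * v / INR n)) (cos (2 * PI
      * v0 / INR n)) Hn ltac:(lra) ltac:(lra)) as HL.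
    rewrite E0 in HL at 2. apply Rabs_le_between in HL. unfold g, m. lra.
  - replace (Finite (RInt (cos_kernel n (cos (2 * PI * v0 / INR n))) 0 1))
      with (Finite (g v0 - 0)) by (unfold g; f_equal; ring).
    apply (is_lim_minus' (fun _ => g v0) m); [apply is_lim_const | exact Hm].
  - replace (Finite (RInt (cos_kernel n (cos (2 * PI * v0 / INR n))) 0 1))
      with (Finite (g v0 + 0)) by (unfold g; f_equal; ring).
    apply (is_lim_plus' (fun _ => g v0) m); [apply is_lim_const | exact Hm].
Qed.

Lemma sin_ne_0_near_PI (t : R) : 0 < t < 2 * PI -> t <> PI -> sin t <> 0.
Proof.
  intros Ht Hne. destruct (Rlt_le_dec t PI).
  - apply Rgt_not_eq, sin_gt_0; lra.
  - apply Rlt_not_eq, sin_lt_0; lra.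
Qed.

(** [is_lim] looks at a punctured neighbourhood, on which the angle differs from [PI] and the
    formula holds; the integral on its right-hand side is continuous at [v0]. *)
Lemma digamma_series_formula_lim (n : nat) (v0 : R) : (1 <= n)%nat -> 2 * v0 = INR n ->
  is_lim (fun v => 2 * INR n / PI * ln (2 * sin (PI * v / INR n))
    - 2 / PI * (digamma (2 / INR n) - digamma (1 / INR n))
    - 2 / PI * csc (2 * PI * v / INR n)
      * Series (fun k : nat =>
          psi_coef n (k + 2) * sin (2 * PI * v * INR (k + 2) / INR n))) v0
    (2 * INR n / PI * RInt (cos_kernel n (cos (2 * PI * v0 / INR n))) 0 1).
Proof.
  intros Hn Hv.
  assert (Hn1 : 1 <= INR n) by (change 1 with (INR 1); apply le_INR; lia).
  pose proof PI_RGT_0 as Hpi.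
  eapply is_lim_ext_loc; [|now apply is_lim_cos_kernel].
  assert (H4 : 0 < INR n / 4) by lra.
  exists (mkposreal _ H4). intros v Hv0 Hne. symmetry.
  unfold ball in Hv0; simpl in Hv0; unfold AbsRing_ball, abs, minus, plus, opp in Hv0; simpl in Hv0.
  apply Rabs_def2 in Hv0.
  assert (Ht : 0 < 2 * PI * v / INR n < 2 * PI).
  { split; [apply Rdiv_lt_0_compat; nra|].
    apply Rmult_lt_reg_r with (INR n); [lra|]. unfold Rdiv.
    rewrite Rmult_assoc, Rinv_l, Rmult_1_r by lra. nra. }
  apply digamma_series_formula; [assumption | exact Ht |].
  apply sin_ne_0_near_PI; [exact Ht|]. intros E. apply Hne.
  apply (f_equal (fun x => x * INR n / PI)) in E.
  replace (2 * PI * v / INR n * INR n / PI) with (2 * v) in E by (field; lra).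
  replace (PI * INR n / PI) with (INR n) in E by (field; lra). lra.
Qed.

(** * Rate of convergence *)

Definition second_diff (a : nat -> R) (k : nat) : R := a k - 2 * a (S k) + a (S (S k)).

(* The second differences are moreover decreasing, so that the sum left over after
   two summations by parts is bounded by its first term. *)
Definition inverse_square_like (a : nat -> R) (c C : R) : Prop :=
  forall k,
    c / (INR k + 1) ^ 2 <= a k <= C / (INR k + 1) ^ 2 /\
    c / (INR k + 1) ^ 3 <= a k - a (S k) <= C / (INR k + 1) ^ 3 /\
    0 <= second_diff a k <= C / (INR k + 1) ^ 4 /\
    second_diff a (S k) <= second_diff a k.

(** Euler's Beta function at [(k + 1, i + 1)]; each factor [1 - s] amounts to one difference in
    [k]. *)
Definition beta_int (k i : nat) : R := RInt (fun s => s ^ k * (1 - s) ^ i) 0 1.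

Lemma beta_int_succ (k i : nat) : beta_int k (S i) = beta_int k i - beta_int (S k) i.
Proof.
  unfold beta_int.
  transitivity (RInt (fun s => 1 * (s ^ k * (1 - s) ^ i) + (-1) * (s ^ S k * (1 - s) ^ i)) 0 1).
  - apply RInt_ext. intros s _. simpl. ring.
  - rewrite RInt_lin by ex_int01. ring.
Qed.

Lemma beta_int_0 (k : nat) : beta_int k 0 = / (INR k + 1).
Proof.
  rewrite <- RInt_01_pow. unfold beta_int. apply RInt_ext. intros s _. simpl. ring.
Qed.

(** The [i]-th iterated difference, from [k] to [k + 1], of the integrals of [beta_kernel n k]. Its
    integrand is nonnegative on [[0, 1]], which gives all the sign and monotonicity conditions at
    once. *)
Definition beta_moment (n k i : nat) : R :=
  RInt (fun s => s ^ k * (1 - s) ^ i * (1 - s ^ 2) / (1 + s ^ n)) 0 1.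

Lemma ex_RInt_beta_moment (n k i : nat) :
  ex_RInt (fun s => s ^ k * (1 - s) ^ i * (1 - s ^ 2) / (1 + s ^ n)) 0 1.
Proof. ex_int01. pose proof (one_plus_pow_pos n t ltac:(lra)). lra. Qed.

Lemma beta_moment_succ (n k i : nat) :
  beta_moment n k (S i) = beta_moment n k i - beta_moment n (S k) i.
Proof.
  unfold beta_moment.
  transitivity (RInt (fun s => 1 * (s ^ k * (1 - s) ^ i * (1 - s ^ 2) / (1 + s ^ n))
                         + (-1) * (s ^ S k * (1 - s) ^ i * (1 - s ^ 2) / (1 + s ^ n))) 0 1).
  - apply RInt_ext. rewrite Rmin_left, Rmax_right by lra. intros s Hs.
    pose proof (one_plus_pow_pos n s ltac:(lra)). simpl. field. simpl in *. lra.
  - rewrite RInt_lin by apply ex_RInt_beta_moment. ring.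
Qed.

(** Write [1 - s^2 = (1 - s) (1 + s)]: both [1 + s] and [1 + s^n] lie between [1] and [2] on
    [[0, 1]]. *)
Lemma beta_moment_bounds (n k i : nat) :
  / 2 * beta_int k (S i) <= beta_moment n k i <= 2 * beta_int k (S i).
Proof.
  unfold beta_int, beta_moment. rewrite <- !RInt_scal_l by ex_int01.
  assert (H : forall s, 0 < s < 1 ->
    / 2 * (s ^ k * (1 - s) ^ S i) <= s ^ k * (1 - s) ^ i * (1 - s ^ 2) / (1
      + s ^ n) <= 2 * (s ^ k * (1 - s) ^ S i)).
  { intros s Hs. pose proof (pow_le_1 s n ltac:(lra)).
    assert (A : 0 <= s ^ k * (1 - s) ^ i) by (apply Rmult_le_pos; apply pow_le; lra).
    assert (B : / 2 * (1 - s) <= (1 - s ^ 2) / (1 + s ^ n) <= 2 * (1 - s)).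
    { split; apply Rmult_le_reg_r with (1 + s ^ n); try lra;
        unfold Rdiv; rewrite (Rmult_assoc (1 - s ^ 2)), Rinv_l by lra; nra. }
    replace (s ^ k * (1 - s) ^ S i) with (s ^ k * (1 - s) ^ i * (1 - s)) by (simpl; ring).
    set (A0 := s ^ k * (1 - s) ^ i) in *.
    unfold Rdiv in *. rewrite (Rmult_assoc A0).
    set (B0 := (1 - s ^ 2) * / (1 + s ^ n)) in *. clearbody A0 B0.
    replace (/ 2 * (A0 * (1 - s))) with (A0 * (/ 2 * (1 - s))) by ring.
    replace (2 * (A0 * (1 - s))) with (A0 * (2 * (1 - s))) by ring.
    split; apply Rmult_le_compat_l; lra. }
  split; apply RInt_le; try lra; try (intros s Hs; now apply H).
  1, 4: ex_int01.
  all: apply ex_RInt_beta_moment.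
Qed.

Lemma Rdiv_le_cross (p q r s : R) : 0 < q -> 0 < s -> p * s <= r * q -> p / q <= r / s.
Proof.
  intros Hq Hs H. apply Rmult_le_reg_r with (q * s); [now apply Rmult_lt_0_compat|].
  replace (p / q * (q * s)) with (p * s) by (field; lra).
  replace (r / s * (q * s)) with (r * q) by (field; lra). exact H.
Qed.

Ltac pos_prod := repeat (apply Rmult_lt_0_compat || apply pow_lt); lra.

(** With [x = k + 1], the constant [1/6] is the [1/2] of [beta_moment_bounds] times [1/3], from
    [x + 1 <= 2 x] and [x + 2 <= 3 x]; [12] is [2] times the numerator of [beta_int k 3]. The second
    differences decrease because the third moment is nonnegative. *)
Lemma inverse_square_like_beta (n : nat) : (1 <= n)%nat ->
  inverse_square_like (fun k => INR n * RInt (beta_kernel n k) 0 1) (INR n / 6) (12 * INR n).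
Proof.
  intros Hn. assert (Hn1 : 1 <= INR n) by (change 1 with (INR 1); apply le_INR; lia).
  set (a := fun k => INR n * RInt (beta_kernel n k) 0 1).
  assert (A0 : forall k, a k = INR n * beta_moment n k 0).
  { intros k. unfold a, beta_moment. f_equal. apply RInt_ext. intros s _. unfold beta_kernel.
    now rewrite pow_O, Rmult_1_r. }
  assert (A1 : forall k, a k - a (S k) = INR n * beta_moment n k 1).
  { intros k. rewrite !A0, beta_moment_succ. ring. }
  assert (A2 : forall k, second_diff a k = INR n * beta_moment n k 2).
  { intros k. unfold second_diff. rewrite !A0, !beta_moment_succ. ring. }
  intros k. set (x := INR k + 1).
  assert (Hx : 1 <= x) by (unfold x; pose proof (pos_INR k); lra).
  assert (B : forall j, beta_int j 1 = / ((INR j + 1) * (INR j + 2)) /\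
                beta_int j 2 = 2 / ((INR j + 1) * (INR j + 2) * (INR j + 3)) /\
                beta_int j 3 = 6 / ((INR j + 1) * (INR j + 2) * (INR j + 3) * (INR j + 4)) /\
                0 <= beta_int j 4).
  { intros j. pose proof (pos_INR j).
    repeat split; try (rewrite !beta_int_succ, !beta_int_0, !S_INR; field; lra).
    apply RInt_ge_0; [lra | ex_int01 |]. intros s Hs. apply Rmult_le_pos; apply pow_le; lra. }
  destruct (B k) as (B1 & B2 & B3 & B4). fold x in B1, B2, B3.
  replace (INR k + 2) with (x + 1) in * by (unfold x; ring).
  replace (INR k + 3) with (x + 2) in * by (unfold x; ring).
  replace (INR k + 4) with (x + 3) in * by (unfold x; ring).
  pose proof (beta_moment_bounds n k 0) as M0. pose proof (beta_moment_bounds n k 1) as M1.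
  pose proof (beta_moment_bounds n k 2) as M2. pose proof (beta_moment_bounds n k 3) as M3.
  rewrite !A2, A1, A0. rewrite B1 in M0. rewrite B2 in M1. rewrite B3 in M2.
  assert (L0 : 1 / 3 / x ^ 2 <= / (x * (x + 1))).
  { rewrite <- (Rmult_1_l (/ _)). apply Rdiv_le_cross; [pos_prod | pos_prod | nra]. }
  assert (U0 : / (x * (x + 1)) <= 1 / x ^ 2).
  { rewrite <- (Rmult_1_l (/ _)). apply Rdiv_le_cross; [pos_prod | pos_prod | nra]. }
  assert (X2 : x <= x * x) by nra. assert (X3 : x * x <= x * x * x) by nra.
  assert (X4 : x * x * x <= x * x * x * x) by nra.
  assert (L1 : 1 / 3 / x ^ 3 <= 2 / (x * (x + 1) * (x + 2))).
  { apply Rdiv_le_cross; [pos_prod | pos_prod | ]. cbn [pow]. nra. }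
  assert (U1 : 2 / (x * (x + 1) * (x + 2)) <= 2 / x ^ 3).
  { apply Rdiv_le_cross; [pos_prod | pos_prod | ]. cbn [pow]. nra. }
  assert (U2 : 6 / (x * (x + 1) * (x + 2) * (x + 3)) <= 6 / x ^ 4).
  { apply Rdiv_le_cross; [pos_prod | pos_prod | ]. cbn [pow].
    replace (x * (x + 1) * (x + 2) * (x + 3))
      with (x * (x * (x * (x * 1))) + 6 * (x * x * x) + 11 * (x * x) + 6 * x) by ring. nra. }
  assert (Z2 : 0 <= 6 / (x * (x + 1) * (x + 2) * (x + 3))).
  { left. apply Rdiv_lt_0_compat; [lra | pos_prod]. }
  assert (E : forall p r, p * INR n / r = INR n * (p / r)) by (intros; unfold Rdiv; ring).
  replace (INR n / 6) with (1 / 6 * INR n) by field. rewrite !E.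
  assert (I2 : 0 < / x ^ 2) by (apply Rinv_0_lt_compat; pos_prod).
  assert (I3 : 0 < / x ^ 3) by (apply Rinv_0_lt_compat; pos_prod).
  assert (I4 : 0 < / x ^ 4) by (apply Rinv_0_lt_compat; pos_prod).
  pose proof (beta_moment_succ n k 2) as D3.
  unfold Rdiv in *.
  repeat split; apply Rmult_le_compat_l || apply Rmult_le_pos; lra.
Qed.

(** With [x = k + 1], [36] comes from [(x + 1)^2 (x + 2)^2 <= 36 x^4], and [6] is the leading
    coefficient of the second difference of [1 / x^2]. *)
Lemma inverse_square_like_inv_sqr :
  inverse_square_like (fun k => / INR (k + 2) ^ 2) (1 / 36) 6.
Proof.
  intros k. unfold second_diff.
  replace (S k + 2)%nat with (k + 3)%nat by lia. replace (S (S k) + 2)%nat with (k + 4)%nat by lia.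
  replace (S (S (S k)) + 2)%nat with (k + 5)%nat by lia.
  set (x := INR k + 1).
  replace (INR (k + 2)) with (x + 1) by (unfold x; rewrite plus_INR; simpl; ring).
  replace (INR (k + 3)) with (x + 2) by (unfold x; rewrite plus_INR; simpl; ring).
  replace (INR (k + 4)) with (x + 3) by (unfold x; rewrite plus_INR; simpl; ring).
  replace (INR (k + 5)) with (x + 4) by (unfold x; rewrite plus_INR; simpl; ring).
  assert (Hx : 1 <= x) by (unfold x; pose proof (pos_INR k); lra).
  assert (X2 : x <= x * x) by nra. assert (X3 : x * x <= x * x * x) by nra.
  assert (X4 : x * x * x <= x * x * x * x) by nra.
  repeat split.
  - rewrite <- (Rmult_1_l (/ _)). apply Rdiv_le_cross; [pos_prod | pos_prod | cbn [pow]; nra].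
  - rewrite <- (Rmult_1_l (/ _)). apply Rdiv_le_cross; [pos_prod | pos_prod | cbn [pow]; nra].
  - replace (/ (x + 1) ^ 2 - / (x + 2) ^ 2) with ((2 * x + 3) / ((x + 1) ^ 2 * (x + 2) ^ 2)) by (field;
      lra).
    apply Rdiv_le_cross; [pos_prod | pos_prod | cbn [pow]; nra].
  - replace (/ (x + 1) ^ 2 - / (x + 2) ^ 2) with ((2 * x + 3) / ((x + 1) ^ 2 * (x + 2) ^ 2)) by (field;
      lra).
    apply Rdiv_le_cross; [pos_prod | pos_prod | cbn [pow]; nra].
  - replace (/ (x + 1) ^ 2 - 2 * / (x + 2) ^ 2 + / (x + 3) ^ 2)
      with ((6 * (x + 2) ^ 2 - 2) / ((x + 1) ^ 2 * (x + 2) ^ 2 * (x + 3) ^ 2)) by (field; lra).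
    left. apply Rdiv_lt_0_compat; [nra | pos_prod].
  - replace (/ (x + 1) ^ 2 - 2 * / (x + 2) ^ 2 + / (x + 3) ^ 2)
      with ((6 * (x + 2) ^ 2 - 2) / ((x + 1) ^ 2 * (x + 2) ^ 2 * (x + 3) ^ 2)) by (field; lra).
    apply Rdiv_le_cross; [pos_prod | pos_prod |].
    apply Rle_trans with ((6 * (x + 2) ^ 2) * ((x + 1) ^ 2 * (x + 3) ^ 2)); [|right; ring].
    apply Rmult_le_compat; [nra | left; pos_prod | lra |].
    replace (x ^ 4) with (x ^ 2 * x ^ 2) by ring.
    apply Rmult_le_compat; try (left; pos_prod); apply pow_incr; lra.
  - match goal with |- ?l <= ?r => enough (0 <= r - l) by lra end.
    match goal with |- 0 <= ?l => replace l with
      ((24 * x ^ 3 + 180 * x ^ 2 + 420 * x + 300) / ((x + 1) ^ 2 * (x + 2) ^ 2 * (x + 3) ^ 2 * (x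
        + 4) ^ 2)) by (field; lra) end.
    left. apply Rdiv_lt_0_compat; [nra | pos_prod].
Qed.

(** * Remainders of sine series by summation by parts *)

Lemma ex_series_inverse_square (u : nat -> R) (C : R) :
  (forall k, Rabs (u k) <= C / (INR k + 1) ^ 2) -> ex_series u.
Proof.
  intros H.
  assert (HC : 0 <= C).
  { specialize (H 0%nat). simpl in H. pose proof (Rabs_pos (u 0%nat)).
    replace (C / ((0 + 1) * ((0 + 1) * 1))) with C in H by field. lra. }
  (* Comparison with a telescoping series: [1 / (k + 1)^2 <= 2 / ((k + 1) (k + 2))]. *)
  apply (ex_series_le (V := R_CompleteNormedModule) u (fun k => (2 * C) * (/ (INR k
    + 1) - / (INR (S k) + 1)))).
  - intros k. eapply Rle_trans; [apply H|]. rewrite S_INR. pose proof (pos_INR k).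
    replace (2 * C * (/ (INR k + 1) - / (INR k + 1 + 1)))
      with (2 * C / ((INR k + 1) * (INR k + 2))) by (field; lra).
    apply Rdiv_le_cross; [pos_prod | pos_prod |].
    replace (2 * C * (INR k + 1) ^ 2) with (C * (2 * (INR k + 1) ^ 2)) by ring.
    apply Rmult_le_compat_l; [assumption|]. nra.
  - exists (2 * C * (1 - 0)). apply is_series_of_sum_lt.
    apply (is_lim_seq_ext (fun N => 2 * C * (1 - / INR (S N)))).
    + intros N. rewrite sum_lt_scal_l, S_INR. f_equal. induction N as [|N IH].
      * simpl. field.
      * cbn [sum_lt]. rewrite <- IH, S_INR. ring.
    + apply (is_lim_seq_scal_l _ (2 * C) (Finite _)). apply is_lim_seq_minus'; [apply is_lim_seq_const|].
      apply (is_lim_seq_incr_1 (fun N => / INR N)).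
      apply (is_lim_seq_inv _ p_infty); [apply is_lim_seq_INR | discriminate].
Qed.

(** Adding the boundary term [d M * e M] closes the induction: one step then changes the sum by
    [(d M - d (S M)) * e (S M)], and these bounds telescope. *)
Lemma abel_bound (d e : nat -> R) (M : nat) :
  (forall k, 0 <= d k) -> (forall k, d (S k) <= d k) -> (forall k, Rabs (e k) <= 1) ->
  Rabs (sum_lt (fun k => d k * (e k - e (S k))) M) <= 2 * d 0%nat.
Proof.
  intros Hd Hdec He.
  assert (H : Rabs (sum_lt (fun k => d k * (e k - e (S k))) M + d M * e M) <= 2 * d 0%nat - d M).
  { induction M as [|M IH]; cbn [sum_lt].
    - rewrite Rplus_0_l, Rabs_mult, (Rabs_pos_eq (d 0%nat)) by apply Hd.
      specialize (Hd 0%nat). specialize (He 0%nat). nra.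
    - replace (_ + _ + _) with ((sum_lt (fun k => d k * (e k - e (S k))) M
        + d M * e M) - (d M - d (S M)) * e (S M)) by ring.
      eapply Rle_trans; [apply Rabs_triang|]. rewrite Rabs_Ropp, Rabs_mult.
      specialize (Hdec M). rewrite (Rabs_pos_eq (d M - d (S M))) by lra.
      specialize (He (S M)). pose proof (Rabs_pos (e (S M))). nra. }
  assert (H2 : Rabs (d M * e M) <= d M).
  { rewrite Rabs_mult, Rabs_pos_eq by apply Hd. specialize (Hd M). specialize (He M). nra. }
  replace (sum_lt (fun k => d k * (e k - e (S k))) M)
    with ((sum_lt (fun k => d k * (e k - e (S k))) M + d M * e M) - d M * e M) by ring.
  eapply Rle_trans; [apply Rabs_triang|]. rewrite Rabs_Ropp. lra.
Qed.

Definition shifted_sin (t : R) (k : nat) : R := sin ((INR k + 2) * t).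

(* [4 sin(t/2)^2 sin(m t)] is minus the second difference of [sin(m t)] in [m]; summing
   by parts twice leaves this boundary term. *)
Definition boundary_term (a : nat -> R) (t : R) (N : nat) : R :=
  a N * (shifted_sin t N - sin ((INR N + 1) * t)) + shifted_sin t N * (a N - a (S N)).

Lemma summation_by_parts_twice (a : nat -> R) (t : R) (N M : nat) :
  4 * sin (t / 2) ^ 2 * sum_lt (fun k => a (N + k)%nat * shifted_sin t (N + k)) M
  = boundary_term a t N - boundary_term a t (N + M)
    - sum_lt (fun k => second_diff a (N + k) * shifted_sin t (S (N + k))) M.
Proof.
  induction M as [|M IH]; cbn [sum_lt].
  - rewrite Nat.add_0_r. ring.
  - rewrite Rmult_plus_distr_l, IH, Nat.add_succ_r.
    set (m := (N + M)%nat).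
    assert (E : 4 * sin (t / 2) ^ 2 * shifted_sin t m
                = 2 * shifted_sin t m - shifted_sin t (S m) - sin ((INR m + 1) * t)).
    { pose proof (sin_step ((INR m + 2) * t) t) as E.
      replace ((INR m + 2) * t + t) with ((INR (S m) + 2) * t) in E by (rewrite S_INR; ring).
      replace ((INR m + 2) * t - t) with ((INR m + 1) * t) in E by ring.
      assert (Ec : cos t = 1 - 2 * sin (t / 2) * sin (t / 2)).
      { rewrite <- cos_2a_sin. f_equal. field. }
      rewrite Ec in E. unfold shifted_sin. nra. }
    replace (4 * sin (t / 2) ^ 2 * (a m * shifted_sin t m))
      with (a m * (4 * sin (t / 2) ^ 2 * shifted_sin t m)) by ring.
    rewrite E. unfold boundary_term, second_diff.
    replace (sin ((INR (S m) + 1) * t)) with (shifted_sin t m) by (unfold shifted_sin; f_equal;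
      rewrite S_INR; ring).
    ring.
Qed.

Lemma shifted_sin_bound (t : R) (k : nat) : Rabs (shifted_sin t k) <= 1.
Proof. apply Rabs_le. pose proof (SIN_bound ((INR k + 2) * t)). unfold shifted_sin. lra. Qed.

Lemma inverse_square_like_const_pos (a : nat -> R) (c C : R) : 0 < c -> inverse_square_like a c C -> 0
  < C.
Proof.
  intros Hc Ha. destruct (Ha 0%nat) as (H & _). simpl in H.
  replace (c / ((0 + 1) * ((0 + 1) * 1))) with c in H by field.
  replace (C / ((0 + 1) * ((0 + 1) * 1))) with C in H by field. lra.
Qed.

Lemma ex_series_weighted_sin (a : nat -> R) (t c C : R) : 0 < c -> inverse_square_like a c C ->
  ex_series (fun k => a k * shifted_sin t k).
Proof.
  intros Hc Ha. apply (ex_series_inverse_square _ C). intros k.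
  destruct (Ha k) as (H & _). pose proof (pos_INR k).
  assert (0 < c / (INR k + 1) ^ 2) by (apply Rdiv_lt_0_compat; [lra | pos_prod]).
  rewrite Rabs_mult, (Rabs_pos_eq (a k)) by lra.
  pose proof (shifted_sin_bound t k). pose proof (Rabs_pos (shifted_sin t k)). nra.
Qed.

Lemma is_lim_seq_inv_shift (N p : nat) : is_lim_seq (fun M => / (INR (N + M) + 1) ^ S p) 0.
Proof.
  apply (is_lim_seq_le_le (fun _ => 0) _ (fun M => / INR (S M))).
  - intros M. rewrite S_INR, plus_INR. pose proof (pos_INR M). pose proof (pos_INR N).
    split; [left; apply Rinv_0_lt_compat, pow_lt; lra|].
    apply Rinv_le_contravar; [lra|]. simpl.
    pose proof (pow_R1_Rle (INR N + INR M + 1) p ltac:(lra)). nra.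
  - apply is_lim_seq_const.
  - apply (is_lim_seq_incr_1 (fun N => / INR N)).
    apply (is_lim_seq_inv _ p_infty); [apply is_lim_seq_INR | discriminate].
Qed.

(** Bounding the sines by [1] would leave the sum of all second differences, that is
    [a N - a (S N)], which is as large as the boundary term when its leading part vanishes. The
    oscillation of the sines has to be used once more, and brings the error down to a single second
    difference, of order [1 / N^4]. *)
Lemma series_tail_boundary (a : nat -> R) (t c C : R) (N : nat) :
  0 < c -> inverse_square_like a c C -> 0 < sin (t / 2) ->
  Rabs (4 * sin (t / 2) ^ 2 * series_tail (fun k => a k * shifted_sin t k) N - boundary_term a t N)
    <= / sin (t / 2) * second_diff a N.
Proof.
  intros Hc Ha Hs.
  pose proof (inverse_square_like_const_pos a c C Hc Ha) as HC.
  set (w := fun k => a k * shifted_sin t k).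
  set (g := sin (t / 2)) in *.
  assert (HS : is_lim_seq (sum_lt (fun k => w (N + k)%nat)) (series_tail w N)).
  { assert (X : ex_series (fun k => w (N + k)%nat)).
    { apply (ex_series_incr_n w N). now apply (ex_series_weighted_sin a t c C). }
    apply Series_correct in X. apply (is_lim_seq_incr_1 (sum_lt _)).
    apply (is_lim_seq_ext (sum_n (fun k => w (N + k)%nat))); [|exact X].
    intros M. induction M as [|M IH].
    - rewrite sum_O. simpl. ring.
    - rewrite sum_Sn, IH. reflexivity. }
  assert (HB : is_lim_seq (fun M => boundary_term a t (N + M)) 0).
  { apply is_lim_seq_abs_0.
    apply (is_lim_seq_le_le (fun _ => 0) _ (fun M => 2 * C * / (INR (N + M) + 1) ^ 2 + C * / (INR (N
      + M) + 1) ^ 3)).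
    - intros M. split; [apply Rabs_pos|]. set (m := (N + M)%nat).
      destruct (Ha m) as (H1 & H2 & _). pose proof (pos_INR m).
      assert (0 < c / (INR m + 1) ^ 2) by (apply Rdiv_lt_0_compat; [lra | pos_prod]).
      assert (0 < c / (INR m + 1) ^ 3) by (apply Rdiv_lt_0_compat; [lra | pos_prod]).
      unfold boundary_term. eapply Rle_trans; [apply Rabs_triang|].
      rewrite !Rabs_mult, (Rabs_pos_eq (a m)), (Rabs_pos_eq (a m - a (S m))) by lra.
      pose proof (shifted_sin_bound t m) as B1. pose proof (Rabs_pos (shifted_sin t m)) as B0.
      assert (B2 : Rabs (shifted_sin t m - sin ((INR m + 1) * t)) <= 2).
      { apply Rabs_le. apply Rabs_le_between in B1. pose proof (SIN_bound ((INR m + 1) * t)). lra. }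
      pose proof (Rabs_pos (shifted_sin t m - sin ((INR m + 1) * t))).
      unfold Rdiv in *. apply Rplus_le_compat; nra.
    - apply is_lim_seq_const.
    - replace (Finite 0) with (Finite (2 * C * 0 + C * 0)) by (f_equal; ring).
      apply is_lim_seq_plus'; [apply (is_lim_seq_scal_l _ (2 * C) 0) | apply (is_lim_seq_scal_l _ C 0)];
        apply is_lim_seq_inv_shift. }
  assert (HD : forall M, Rabs (4 * g ^ 2 * sum_lt (fun k => w (N
    + k)%nat) M - (boundary_term a t N - boundary_term a t (N + M)))
             <= / g * second_diff a N).
  { intros M. unfold w. unfold g at 1. rewrite summation_by_parts_twice. fold g.
    match goal with |- Rabs ?z <= _ => replace z with
      (- sum_lt (fun k => second_diff a (N + k) * shifted_sin t (S (N + k))) M) by ring end.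
    rewrite Rabs_Ropp.
    (* Cosines at half-integer multiples of [t]: consecutive ones differ by [2 sin (t / 2)] times
       the sine between them. *)
    set (e := fun k => cos ((INR (N + k) + 2 + / 2) * t)).
    rewrite (sum_lt_ext _ (fun k => / (2 * g) * (second_diff a (N + k) * (e k - e (S k))))).
    2: { intros k _. unfold e, shifted_sin. rewrite Nat.add_succ_r, !S_INR.
         replace ((INR (N + k) + 2 + / 2) * t) with ((INR (N + k) + 1 + 2) * t - t / 2) by field.
         replace ((INR (N + k) + 1 + 2 + / 2) * t) with ((INR (N + k) + 1 + 2) * t + t / 2) by field.
         rewrite cos_minus, cos_plus. fold g. field. lra. }
    rewrite sum_lt_scal_l, Rabs_mult, Rabs_pos_eq by (left; apply Rinv_0_lt_compat; lra).
    assert (HA : Rabs (sum_lt (fun k => second_diff a (N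
      + k) * (e k - e (S k))) M) <= 2 * second_diff a N).
    { pose proof (abel_bound (fun k => second_diff a (N + k)) e M) as HA. cbv beta in HA.
      rewrite Nat.add_0_r in HA.
      apply HA; intros k.
      - apply Ha.
      - rewrite Nat.add_succ_r. apply Ha.
      - apply Rabs_le. unfold e. pose proof (COS_bound ((INR (N + k) + 2 + / 2) * t)). lra. }
    replace (/ g * second_diff a N) with (/ (2 * g) * (2 * second_diff a N)) by (field; lra).
    apply Rmult_le_compat_l; [left; apply Rinv_0_lt_compat; lra | exact HA]. }
  assert (HL : is_lim_seq (fun M => Rabs (4 * g ^ 2 * sum_lt (fun k => w (N
    + k)%nat) M - (boundary_term a t N - boundary_term a t (N + M))))
             (Rabs (4 * g ^ 2 * series_tail w N - (boundary_term a t N - 0)))).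
  { apply (is_lim_seq_abs _ (Finite _)). apply is_lim_seq_minus'.
    - now apply (is_lim_seq_scal_l _ (4 * g ^ 2) (Finite _)).
    - apply is_lim_seq_minus'; [apply is_lim_seq_const | exact HB]. }
  rewrite Rminus_0_r in HL.
  exact (is_lim_seq_le _ _ (Finite _) (Finite _) HD HL (is_lim_seq_const _)).
Qed.

(** A periodic sequence takes finitely many values. This turns a nonzero trigonometric factor into a
    lower bound uniform in the index. *)
Lemma periodic_gap (f : nat -> R) (n : nat) : (1 <= n)%nat -> (forall k, f (n + k)%nat = f k) ->
  exists d, 0 < d /\ forall k, f k <> 0 -> d <= Rabs (f k).
Proof.
  intros Hn Hp.
  assert (H : forall m, exists d, 0 < d /\ forall k, (k < m)%nat -> f k <> 0 -> d <= Rabs (f k)).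
  { induction m as [|m (d & Hd & H)].
    - exists 1. split; [lra | intros; lia].
    - destruct (Req_dec (f m) 0) as [E|E].
      + exists d. split; [assumption|]. intros k Hk Hf.
        destruct (Nat.eq_dec k m) as [->|]; [contradiction | apply H; [lia | assumption]].
      + exists (Rmin d (Rabs (f m))). split; [apply Rmin_glb_lt; [assumption | now apply Rabs_pos_lt]|].
        intros k Hk Hf. destruct (Nat.eq_dec k m) as [->|]; [apply Rmin_r|].
        eapply Rle_trans; [apply Rmin_l | apply H; [lia | assumption]]. }
  destruct (H n) as (d & Hd & Hd'). exists d. split; [assumption|].
  intros k. induction k as [k IH] using (well_founded_induction Wf_nat.lt_wf). intros Hf.
  destruct (Nat.lt_ge_cases k n) as [Hlt|Hge]; [now apply Hd'|].
  replace k with (n + (k - n))%nat in * by lia. rewrite Hp in *. apply IH; [lia | assumption].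
Qed.

Lemma same_order_common (u v w : nat -> R) : same_order u w -> same_order v w -> same_order u v.
Proof.
  intros (c1 & c2 & H1 & H2 & N1 & Hu) (d1 & d2 & G1 & G2 & N2 & Hv).
  exists (c1 / d2), (c2 / d1). repeat split; try now apply Rdiv_lt_0_compat.
  exists (N1 + N2)%nat. intros N HN. specialize (Hu N ltac:(lia)). specialize (Hv N ltac:(lia)).
  pose proof (Rabs_pos (w N)).
  split; apply Rmult_le_reg_l with (d1 * d2); try (now apply Rmult_lt_0_compat).
  - replace (d1 * d2 * (c1 / d2 * Rabs (v N))) with (d1 * c1 * Rabs (v N)) by (field; lra).
    apply Rle_trans with (d1 * c1 * (d2 * Rabs (w N))).
    + apply Rmult_le_compat_l; [left; now apply Rmult_lt_0_compat | lra].
    + replace (d1 * c1 * (d2 * Rabs (w N))) with (d1 * d2 * (c1 * Rabs (w N))) by ring.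
      apply Rmult_le_compat_l; [left; now apply Rmult_lt_0_compat | lra].
  - replace (d1 * d2 * (c2 / d1 * Rabs (v N))) with (d2 * c2 * Rabs (v N)) by (field; lra).
    apply Rle_trans with (d2 * c2 * (d1 * Rabs (w N))).
    + replace (d2 * c2 * (d1 * Rabs (w N))) with (d1 * d2 * (c2 * Rabs (w N))) by ring.
      apply Rmult_le_compat_l; [left; now apply Rmult_lt_0_compat | lra].
    + apply Rmult_le_compat_l; [left; now apply Rmult_lt_0_compat | lra].
Qed.

Lemma same_order_ext (u u' v : nat -> R) : (forall N, Rabs (u' N)
  = Rabs (u N)) -> same_order u v -> same_order u' v.
Proof.
  intros H (c1 & c2 & H1 & H2 & N0 & Hu). exists c1, c2. repeat split; try assumption.
  exists N0. intros N HN. rewrite H. now apply Hu.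
Qed.

(* At the indices [N] with [sin ((N + 2) t) = sin ((N + 1) t)] the leading part of the
   remainder vanishes and its order drops from [1 / N^2] to [1 / N^3]. *)
Definition tail_scale (t : R) (N : nat) : R :=
  if Req_dec_T (shifted_sin t N - sin ((INR N + 1) * t)) 0
  then / (INR N + 1) ^ 3 else / (INR N + 1) ^ 2.

(** If [p N] is nonzero, the boundary term is dominated by [a N * p N], of order [1 / N^2].
    Otherwise it is exactly [shifted_sin t N] times the first difference of [a], of order [1 / N^3].
    In both cases the error of order [1 / N^4] is negligible. *)
Lemma same_order_tail (a : nat -> R) (t c C : R) (n nu : nat) : (1 <= n)%nat ->
  0 < c -> inverse_square_like a c C ->
  0 < t < 2 * PI -> t <> PI -> INR n * t = 2 * INR nu * PI ->
  same_order (series_tail (fun k => a k * shifted_sin t k)) (tail_scale t).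
Proof.
  intros Hn Hc Ha Ht Hpi Hper.
  pose proof (inverse_square_like_const_pos a c C Hc Ha) as HC.
  assert (Hg : 0 < sin (t / 2)) by (apply sin_gt_0; lra).
  assert (HperS : forall x, sin (x + INR n * t) = sin x) by (intros x; rewrite Hper; apply sin_period).
  set (p := fun k => shifted_sin t k - sin ((INR k + 1) * t)).
  assert (P1 : forall k, shifted_sin t (n + k) = shifted_sin t k).
  { intros k. unfold shifted_sin. rewrite plus_INR, <- (HperS ((INR k + 2) * t)). f_equal. ring. }
  assert (P2 : forall k, p (n + k)%nat = p k).
  { intros k. unfold p. rewrite P1. f_equal. rewrite plus_INR, <- (HperS ((INR k + 1) * t)). f_equal.
    ring. }
  destruct (periodic_gap _ n Hn P1) as (d1 & D1 & G1).
  destruct (periodic_gap _ n Hn P2) as (d2 & D2 & G2).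
  set (d := Rmin d1 d2).
  assert (Hd : 0 < d) by now apply Rmin_glb_lt.
  assert (Hd1 : d <= d1) by apply Rmin_l. assert (Hd2 : d <= d2) by apply Rmin_r.
  set (g := sin (t / 2)) in *. set (K := / g).
  assert (HK : 0 < K) by now apply Rinv_0_lt_compat.
  assert (Hg2 : 0 < 4 * g ^ 2) by (pose proof (pow_lt g 2 Hg); lra).
  (* Beyond this threshold the lower-order terms are at most half of the main term, whence the
     factor [c * d / 2] below. *)
  destruct (nfloor_ex (2 * C * (1 + K) / (c * d))) as [N0 HN0].
  { left. apply Rdiv_lt_0_compat; repeat apply Rmult_lt_0_compat; lra. }
  (* In the upper constant, [2 C] bounds [a N * p N] since [|p N| <= 2], [C] the first difference of
     [a], and [K C] the error of [series_tail_boundary]. *)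
  exists (c * d / 2 / (4 * g ^ 2)), ((3 * C + K * C) / (4 * g ^ 2)).
  assert (Hcd : 0 < c * d) by now apply Rmult_lt_0_compat.
  assert (HKC : 0 < K * C) by now apply Rmult_lt_0_compat.
  repeat split; try (apply Rdiv_lt_0_compat; lra).
  exists N0. intros N HN. apply le_INR in HN.
  set (S := series_tail (fun k => a k * shifted_sin t k) N).
  set (x := INR N + 1).
  assert (Hx : 1 <= x) by (unfold x; pose proof (pos_INR N); lra).
  assert (Hbig : 2 * C * (1 + K) <= c * d * x).
  { apply Rmult_le_reg_r with (/ (c * d)); [now apply Rinv_0_lt_compat|].
    replace (c * d * x * / (c * d)) with x by (field; lra). unfold x, Rdiv in *. lra. }
  assert (HT : Rabs (4 * g ^ 2 * S - boundary_term a t N) <= K * second_diff a N)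
    by now apply (series_tail_boundary a t c C).
  destruct (Ha N) as (A0 & A1 & A2 & _). fold x in A0, A1, A2.
  set (i := / x). assert (Hi : 0 < i <= 1).
  { unfold i. split; [apply Rinv_0_lt_compat; lra|]. rewrite <- Rinv_1. apply Rinv_le_contravar; lra. }
  assert (Hix : c * d * i ^ 3 >= 2 * C * (1 + K) * i ^ 4).
  { replace (c * d * i ^ 3) with (c * d * x * i ^ 4) by (unfold i; field; lra).
    apply Rle_ge, Rmult_le_compat_r; [apply pow_le; lra | assumption]. }
  assert (Hix2 : c * d * i ^ 2 >= 2 * C * (1 + K) * i ^ 3).
  { replace (c * d * i ^ 2) with (c * d * x * i ^ 3) by (unfold i; field; lra).
    apply Rle_ge, Rmult_le_compat_r; [apply pow_le; lra | assumption]. }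
  unfold Rdiv in A0, A1, A2. rewrite <- !pow_inv in A0, A1, A2. fold i in A0, A1, A2.
  assert (I2 : 0 < i ^ 2) by (apply pow_lt; lra).
  assert (I3 : 0 < i ^ 3 <= i ^ 2) by (split; [apply pow_lt; lra | simpl; nra]).
  assert (I4 : 0 < i ^ 4 <= i ^ 3) by (split; [apply pow_lt; lra | simpl in *; nra]).
  assert (HA2 : K * second_diff a N <= K * C * i ^ 4) by (rewrite Rmult_assoc; apply Rmult_le_compat_l;
    lra).
  assert (B1 := shifted_sin_bound t N). assert (B1p := Rabs_pos (shifted_sin t N)).
  assert (E4 : Rabs S = Rabs (4 * g ^ 2 * S) / (4 * g ^ 2)).
  { rewrite Rabs_mult, (Rabs_pos_eq (4 * g ^ 2)) by lra. field. lra. }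
  assert (Main : forall y, 0 < y ->
     c * d / 2 * y <= Rabs (4 * g ^ 2 * S) <= (3 * C + K * C) * y ->
     c * d / 2 / (4 * g ^ 2) * Rabs y <= Rabs S <= (3 * C + K * C) / (4 * g ^ 2) * Rabs y).
  { intros y Hy Hb. rewrite E4, (Rabs_pos_eq y) by lra.
    pose proof (Rinv_0_lt_compat _ Hg2) as HI. unfold Rdiv in *.
    split.
    - replace (c * d * / 2 * / (4 * g ^ 2) * y) with (c * d * / 2 * y * / (4 * g ^ 2)) by ring.
      apply Rmult_le_compat_r; lra.
    - replace ((3 * C + K * C) * / (4 * g ^ 2) * y) with ((3 * C + K * C) * y * / (4 * g ^ 2)) by ring.
      apply Rmult_le_compat_r; lra. }
  set (T := 4 * g ^ 2 * S) in *.
  assert (HTT : Rabs (boundary_term a t N) - K * C * i ^ 4 <= Rabs T <= Rabs (boundary_term a t N)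
    + K * C * i ^ 4).
  { pose proof (Rabs_triang_inv T (boundary_term a t N)).
    pose proof (Rabs_triang_inv (boundary_term a t N) T) as X. rewrite Rabs_minus_sym in X. lra. }
  unfold tail_scale. fold (p N). fold x.
  destruct (Req_dec_T (p N) 0) as [Hp|Hp].
  - rewrite <- pow_inv. fold i. apply Main; [lra|].
    assert (HB : Rabs (boundary_term a t N) = Rabs (shifted_sin t N) * (a N - a (Datatypes.S N))).
    { unfold boundary_term. fold (p N). rewrite Hp, Rmult_0_r, Rplus_0_l, Rabs_mult.
      rewrite (Rabs_pos_eq (a N - a (Datatypes.S N))); [reflexivity|].
      assert (0 < c * i ^ 3) by (apply Rmult_lt_0_compat; lra). lra. }
    (* As [p N = 0], a zero here would make two consecutive sines vanish and force [sin t = 0]. *)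
    assert (Hsin : shifted_sin t N <> 0).
    { intros E0. apply (sin_ne_0_near_PI t Ht Hpi).
      assert (E1 : sin ((INR N + 1) * t) = 0) by (unfold p in Hp; lra).
      replace t with ((INR N + 2) * t - (INR N + 1) * t) by ring.
      rewrite sin_minus, E1. unfold shifted_sin in E0. rewrite E0. ring. }
    specialize (G1 N Hsin). rewrite HB in HTT.
    set (r := Rabs (shifted_sin t N)) in *. set (q := a N - a (Datatypes.S N)) in *.
    assert (L : c * d * i ^ 3 <= r * q).
    { replace (c * d * i ^ 3) with (d * (c * i ^ 3)) by ring.
      apply Rmult_le_compat; try lra. apply Rmult_le_pos; lra. }
    assert (U : r * q <= C * i ^ 3).
    { assert (0 <= q) by (assert (0 < c * i ^ 3) by (apply Rmult_lt_0_compat; lra); lra). nra. }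
    assert (0 < C * i ^ 4) by (apply Rmult_lt_0_compat; lra).
    assert (0 < C * i ^ 3) by (apply Rmult_lt_0_compat; lra).
    assert (K * C * i ^ 4 <= K * C * i ^ 3) by (apply Rmult_le_compat_l; lra).
    split; lra.
  - rewrite <- pow_inv. fold i. apply Main; [lra|].
    specialize (G2 N Hp).
    assert (Bp : Rabs (p N) <= 2).
    { apply Rabs_le. apply Rabs_le_between in B1. pose proof (SIN_bound ((INR N + 1) * t)). unfold p.
      lra. }
    assert (Cpos : 0 < c * i ^ 2 /\ 0 < c * i ^ 3) by (split; apply Rmult_lt_0_compat; lra).
    assert (HB : Rabs (boundary_term a t N - a N * p N) <= C * i ^ 3).
    { unfold boundary_term. fold (p N).
      replace (a N * p N + shifted_sin t N * (a N - a (Datatypes.S N)) - a N * p N)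
        with (shifted_sin t N * (a N - a (Datatypes.S N))) by ring.
      rewrite Rabs_mult, (Rabs_pos_eq (a N - a (Datatypes.S N))) by lra. nra. }
    assert (HBB : Rabs (a N * p N) - C * i ^ 3 <= Rabs (boundary_term a t N) <= Rabs (a N * p N)
      + C * i ^ 3).
    { pose proof (Rabs_triang_inv (boundary_term a t N) (a N * p N)).
      pose proof (Rabs_triang_inv (a N * p N) (boundary_term a t N)) as X. rewrite Rabs_minus_sym in X.
      lra. }
    rewrite Rabs_mult, (Rabs_pos_eq (a N)) in HBB by lra.
    assert (L : c * d * i ^ 2 <= a N * Rabs (p N)).
    { replace (c * d * i ^ 2) with (c * i ^ 2 * d) by ring. apply Rmult_le_compat; lra. }
    assert (U : a N * Rabs (p N) <= 2 * (C * i ^ 2)).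
    { rewrite (Rmult_comm 2). apply Rmult_le_compat; try lra. }
    assert (C * i ^ 3 <= C * i ^ 2) by (apply Rmult_le_compat_l; lra).
    assert (K * C * i ^ 4 <= K * C * i ^ 3) by (apply Rmult_le_compat_l; lra).
    assert (K * C * i ^ 3 <= K * C * i ^ 2) by (apply Rmult_le_compat_l; lra).
    split; lra.
Qed.

Lemma same_order_weighted_sin (a : nat -> R) (t c C : R) : 0 < c -> inverse_square_like a c C ->
  same_order (fun k => a k * shifted_sin t k) (fun k => shifted_sin t k / (INR k + 1) ^ 2).
Proof.
  intros Hc Ha. pose proof (inverse_square_like_const_pos a c C Hc Ha) as HC.
  exists c, C. repeat split; try assumption. exists 0%nat. intros k _.
  destruct (Ha k) as (H & _). pose proof (pos_INR k).
  assert (0 < / (INR k + 1) ^ 2) by (apply Rinv_0_lt_compat; pos_prod).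
  assert (0 < c / (INR k + 1) ^ 2) by (apply Rdiv_lt_0_compat; [lra | pos_prod]).
  unfold Rdiv in *.
  rewrite !Rabs_mult, (Rabs_pos_eq (a k)), (Rabs_pos_eq (/ (INR k + 1) ^ 2)) by lra.
  pose proof (Rabs_pos (shifted_sin t k)). split; nra.
Qed.

Lemma same_rate_inverse_square_like (a b : nat -> R) (t ca Ca cb Cb : R) (n nu : nat) : (1 <= n)%nat ->
  0 < ca -> 0 < cb -> inverse_square_like a ca Ca -> inverse_square_like b cb Cb ->
  0 < t < 2 * PI -> INR n * t = 2 * INR nu * PI ->
  same_rate (fun k => a k * shifted_sin t k) (fun k => b k * shifted_sin t k).
Proof.
  intros Hn Hca Hcb Ha Hb Ht Hper.
  split; [now apply (ex_series_weighted_sin a t ca Ca)|].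
  split; [now apply (ex_series_weighted_sin b t cb Cb)|].
  split.
  { apply (same_order_common _ _ (fun k => shifted_sin t k / (INR k + 1) ^ 2)).
    - now apply (same_order_weighted_sin a t ca Ca).
    - now apply (same_order_weighted_sin b t cb Cb). }
  (* At [t = PI] all terms and all remainders are zero, so they are compared directly and not
     through the positive [tail_scale]. *)
  destruct (Req_dec t PI) as [->|Hpi].
  - assert (Z : forall c N, series_tail (fun k => c k * shifted_sin PI k) N = 0).
    { intros c N. unfold series_tail. rewrite (Series_ext _ (fun _ => 0)).
      - apply (is_series_unique (fun _ => 0) 0), is_series_of_sum_lt.
        apply (is_lim_seq_ext (fun _ => 0)); [|apply is_lim_seq_const].
        intros M. induction M as [|M IH]; cbn [sum_lt]; lra.
      - intros k. unfold shifted_sin.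
        replace ((INR (N + k) + 2) * PI) with (INR (N + k) * PI + 2 * INR 1 * PI) by (simpl; ring).
        rewrite sin_period. replace (sin (INR (N + k) * PI)) with 0; [ring|].
        symmetry. apply sin_eq_0_1. exists (Z.of_nat (N + k)). now rewrite <- INR_IZR_INZ. }
    exists 1, 1. split; [lra|]. split; [lra|]. exists 0%nat. intros N _. rewrite !Z. lra.
  - apply (same_order_common _ _ (tail_scale t)).
    + now apply (same_order_tail a t ca Ca n nu).
    + now apply (same_order_tail b t cb Cb n nu).
Qed.

Lemma same_rate_opp (u u' v : nat -> R) : (forall k, u' k = - u k) -> same_rate u v -> same_rate u' v.
Proof.
  intros E (H1 & H2 & H3 & H4).
  split; [|split; [assumption|split]].
  - apply (ex_series_ext (fun k => opp (u k))); [intros; symmetry; apply E|].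
    now apply (ex_series_opp (V := R_NormedModule)).
  - eapply same_order_ext; [|exact H3]. intros N. rewrite E. apply Rabs_Ropp.
  - eapply same_order_ext; [|exact H4]. intros N. unfold series_tail.
    rewrite (Series_ext _ (fun k => - u (N + k)%nat)) by (intros; apply E).
    rewrite Series_opp. apply Rabs_Ropp.
Qed.

Lemma same_rate_ext_r (u v v' : nat -> R) : (forall k, v k = v' k) ->
  same_rate u v -> same_rate u v'.
Proof.
  intros E H. now rewrite <- (FunctionalExtensionality.functional_extensionality _ _ E).
Qed.

(* The series over l >= 2 are indexed by k = l - 2. *)
Theorem theorem3 (n nu : nat) (hn : (2 <= n)%nat) (hnu : (1 <= nu <= n - 1)%nat) :
  let C : R :=
    sum_n_m (fun l : nat =>
      cos (2 * PI * INR nu * INR l / INR n) * csc (PI * INR l / INR n)) 1 (n - 1) in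
  let rhs (v : R) : R :=
    2 * INR n / PI * ln (2 * sin (PI * v / INR n))
    - 2 / PI * (digamma (2 / INR n) - digamma (1 / INR n))
    - 2 / PI * csc (2 * PI * v / INR n)
      * Series (fun k : nat =>
          psi_coef n (k + 2) * sin (2 * PI * v * INR (k + 2) / INR n)) in
  ((2 * nu)%nat <> n -> C = rhs (INR nu)) /\
  (* for nu = n/2 the product csc * series has a removable singularity *)
  ((2 * nu)%nat = n -> is_lim rhs (INR nu) C) /\
  same_rate
    (fun k : nat =>
       psi_coef n (k + 2) * sin (2 * PI * INR nu * INR (k + 2) / INR n))
    (fun k : nat =>
       / INR (k + 2) ^ 2 * sin (2 * PI * INR nu * INR (k + 2) / INR n)).
Proof.
  intros C rhs.
  pose proof PI_RGT_0 as Hpi.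
  assert (Hn : 2 <= INR n) by (change 2 with (INR 2); apply le_INR; lia).
  assert (Hnu : 1 <= INR nu) by (change 1 with (INR 1); apply le_INR; lia).
  assert (Hnun : INR nu < INR n) by (apply lt_INR; lia).
  pose proof (cos_csc_sum_RInt n nu hn hnu) as HC. fold C in HC.
  set (t := 2 * PI * INR nu / INR n) in *.
  assert (Hnt : INR n * t = 2 * INR nu * PI) by (unfold t; field; lra).
  assert (Ht : 0 < t < 2 * PI).
  { split; [apply Rdiv_lt_0_compat; nra|]. apply Rmult_lt_reg_l with (INR n); [lra|]. rewrite Hnt. nra. }
  split; [|split].
  - intros Hne. rewrite HC. symmetry. apply digamma_series_formula; [lia | exact Ht |].
    apply sin_ne_0_near_PI; [exact Ht|]. intros E. apply Hne.
    fold t in E. rewrite E in Hnt. apply INR_eq. rewrite mult_INR. change (INR 2) with 2.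
    apply Rmult_eq_reg_r with PI; [symmetry; exact Hnt | lra].
  - intros Heq. rewrite HC. apply digamma_series_formula_lim; [lia|].
    rewrite <- Heq, mult_INR. reflexivity.
  - assert (HS : forall k, sin (2 * PI * INR nu * INR (k + 2) / INR n) = shifted_sin t k).
    { intros k. unfold shifted_sin, t. f_equal. rewrite plus_INR. simpl (INR 2). field. lra. }
    (* The coefficients [psi_coef] are negative, whereas [inverse_square_like] describes positive
       sequences. *)
    apply (same_rate_opp (fun k => INR n * RInt (beta_kernel n k) 0 1 * shifted_sin t k)).
    { intros k. rewrite HS, psi_coef_RInt by lia. ring. }
    apply (same_rate_ext_r _ (fun k => / INR (k + 2) ^ 2 * shifted_sin t k)); [intros k;
      now rewrite HS|].
    apply (same_rate_inverse_square_like _ _ t (INR n / 6) (12 * INR n) (1 / 36) 6 n nu); try lia;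
      try lra; try assumption.
    + apply inverse_square_like_beta. lia.
    + apply inverse_square_like_inv_sqr.
Qed.
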